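(* Let $Q$ be a finite quiver without edge loops, let $d$ be a dimension vector for $Q$, and let $\delta$ be an imaginary root of $Q$ satisfying condition $(\ast)$ for the Cartan form of $Q$. For those $n$ for which $A_{d+n\delta}\neq 0$, write the Kac polynomial of the dimension vector $d+n\delta$ as $$A_{d+n\delta}(q)=\sum_{i=0}^{\deg A_{d+n\delta}}a_i^{(d+n\delta)}q^{\deg A_{d+n\delta}-i}.$$ Then for every $i\ge 0$ the coefficients $a_i^{(d+n\delta)}$ stabilize for sufficiently large $n$ with $d+n\delta$ indivisible; that is, there are a number $a_i$ and an integer $N_i$ such that $a_i^{(d+n\delta)}=a_i$ for all $n\ge N_i$ with $d+n\delta$ indivisible. Moreover, the generating function of the stabilized coefficients is $$\sum_{i\ge 0}a_iq^i=\frac{(1-q)\,p^{|\operatorname{supp}\delta|}(q)}{\prod_{i\notin\operatorname{supp}\delta}\prod_{k=1}^{d_i}(1-q^k)}.$$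
   Context: A quiver is $Q=(Q_0,Q_1)$ with vertex set $Q_0$ and arrow set $Q_1$; a dimension vector is an element of $\mathbb{Z}_{\ge 0}^{Q_0}$, and it is indivisible if it is nonzero and the gcd of its entries is $1$. The Euler form is $\langle d,v\rangle=\sum_{i\in Q_0}d_iv_i-\sum_{i\to j}d_iv_j$ (second sum over arrows), and the Cartan form is $(d,v)=\langle d,v\rangle+\langle v,d\rangle$. $e_i$ is the dimension vector with $1$ at vertex $i$ and $0$ elsewhere; $\operatorname{supp}\delta=\{i\in Q_0:\delta_i\ne 0\}$, also regarded as a full subquiver. Roots of $Q$ are roots of the Kac-Moody Lie algebra $\mathfrak{g}_Q$ attached to the underlying graph of $Q$. Condition $(\ast)$ for the Cartan form: $(e_i,\delta)<0$ for all $i\in Q_0$, and, if $\{C_k\}$ are the connected components of $\operatorname{supp}\delta$, then for all $k,l$ with $C_k\neq C_l$ there is an edge between $C_k$ and $C_l$ or a vertex of $Q$ joined by edges to both $C_k$ and $C_l$. Kac polynomial: $A_d(q)$ is the polynomial in $q$ whose value at each prime power $q$ is the number of isomorphism classes of absolutely indecomposable representations of $Q$ of dimension vector $d$ over $\mathbb{F}_q$. When $d$ is a root, $\deg A_d=1-\langle d,d\rangle$; $A_d\ne 0$ if and only if $d$ is a root. $p^l(q)=\prod_{m\ge 1}(1-q^m)^{-l}$ is the generating function of the number of partitions in $l$ colors. *)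

(* Defs.v *)
From HB Require Import structures.
From mathcomp Require Import all_boot all_order all_algebra all_field.
From mathcomp Require Import boolp.

Set Implicit Arguments.
Unset Strict Implicit.
Unset Printing Implicit Defensive.

Import Order.TTheory GRing.Theory Num.Theory.
Local Open Scope ring_scope.

Record quiver := Quiver {
  vertex : finType;
  arrow : finType;
  src : arrow -> vertex;
  tgt : arrow -> vertex
}.

Definition loop_free (Q : quiver) : Prop := forall a : arrow Q, src a != tgt a.

Definition adjacent (Q : quiver) : rel (vertex Q) := fun i j =>
  [exists a : arrow Q, ((src a == i) && (tgt a == j))
                    || ((src a == j) && (tgt a == i))].

Definition dimvec (Q : quiver) := {ffun vertex Q -> nat}.

(* The root lattice Z^{Q_0}, which contains the dimension vectors. *)
Definition lattice (Q : quiver) := {ffun vertex Q -> int}.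

Definition to_lattice (Q : quiver) (d : dimvec Q) : lattice Q :=
  [ffun i => (d i)%:Z].

Definition indivisible (Q : quiver) (d : dimvec Q) : bool :=
  (d != 0) && (\big[gcdn/0%N]_(i : vertex Q) d i == 1%N).

Definition supp (Q : quiver) (d : dimvec Q) : {set vertex Q} :=
  [set i | d i != 0%N].

Definition simple_root (Q : quiver) (i : vertex Q) : lattice Q :=
  [ffun j => (i == j)%:Z].

Definition euler_form (Q : quiver) (x y : lattice Q) : int :=
  \sum_(i : vertex Q) x i * y i - \sum_(a : arrow Q) x (src a) * y (tgt a).

Definition cartan_form (Q : quiver) (x y : lattice Q) : int :=
  euler_form x y + euler_form y x.

Definition cartan_entry (Q : quiver) (i j : vertex Q) : int :=
  cartan_form (simple_root i) (simple_root j).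

(* The (derived) Kac-Moody Lie algebra of the underlying graph, by the
   Chevalley-Serre presentation: lie_eq is the congruence on formal Lie
   expressions generated by the vector space and Lie algebra axioms and by the
   Chevalley-Serre relations, and the Lie algebra is the quotient.  The Cartan
   matrix is integral and symmetric, so the root multiplicities do not depend
   on the ground field of characteristic 0, and the Serre relations generate
   the maximal ideal of Kac's definition (Gabber-Kac).  Enlarging the span of
   the h_i to a realization of the Cartan matrix leaves the components of
   nonzero degree unchanged. *)
Inductive lie_term (Q : quiver) : Type :=
  | LieE of vertex Q
  | LieF of vertex Q
  | LieH of vertex Q
  | LieZero
  | LieAdd of lie_term Q & lie_term Q
  | LieScale of rat & lie_term Q
  | LieBr of lie_term Q & lie_term Q.

Arguments LieZero {Q}.

Inductive lie_eq (Q : quiver) : lie_term Q -> lie_term Q -> Prop :=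
  | lie_refl x : lie_eq x x
  | lie_sym x y : lie_eq x y -> lie_eq y x
  | lie_trans x y z : lie_eq x y -> lie_eq y z -> lie_eq x z
  | lie_add_congr x x' y y' : lie_eq x x' -> lie_eq y y' ->
      lie_eq (LieAdd x y) (LieAdd x' y')
  | lie_scale_congr c x x' : lie_eq x x' ->
      lie_eq (LieScale c x) (LieScale c x')
  | lie_br_congr x x' y y' : lie_eq x x' -> lie_eq y y' ->
      lie_eq (LieBr x y) (LieBr x' y')
  | lie_addA x y z :
      lie_eq (LieAdd x (LieAdd y z)) (LieAdd (LieAdd x y) z)
  | lie_addC x y : lie_eq (LieAdd x y) (LieAdd y x)
  | lie_add0 x : lie_eq (LieAdd LieZero x) x
  | lie_addN x : lie_eq (LieAdd x (LieScale (- 1) x)) LieZero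
  | lie_scaleA b c x :
      lie_eq (LieScale b (LieScale c x)) (LieScale (b * c) x)
  | lie_scale1 x : lie_eq (LieScale 1 x) x
  | lie_scaleDr c x y :
      lie_eq (LieScale c (LieAdd x y)) (LieAdd (LieScale c x) (LieScale c y))
  | lie_scaleDl b c x :
      lie_eq (LieScale (b + c) x) (LieAdd (LieScale b x) (LieScale c x))
  | lie_brDl x y z :
      lie_eq (LieBr (LieAdd x y) z) (LieAdd (LieBr x z) (LieBr y z))
  | lie_brDr x y z :
      lie_eq (LieBr z (LieAdd x y)) (LieAdd (LieBr z x) (LieBr z y))
  | lie_brZl c x y : lie_eq (LieBr (LieScale c x) y) (LieScale c (LieBr x y))
  | lie_brZr c x y : lie_eq (LieBr x (LieScale c y)) (LieScale c (LieBr x y))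
  | lie_brxx x : lie_eq (LieBr x x) LieZero
  | lie_jacobi x y z :
      lie_eq (LieAdd (LieBr x (LieBr y z))
                (LieAdd (LieBr y (LieBr z x)) (LieBr z (LieBr x y)))) LieZero
  | lie_HH i j : lie_eq (LieBr (LieH i) (LieH j)) LieZero
  | lie_HE i j : lie_eq (LieBr (LieH i) (LieE j))
                        (LieScale (cartan_entry i j)%:~R (LieE j))
  | lie_HF i j : lie_eq (LieBr (LieH i) (LieF j))
                        (LieScale (- (cartan_entry i j)%:~R) (LieF j))
  | lie_EF i : lie_eq (LieBr (LieE i) (LieF i)) (LieH i)
  | lie_EF0 i j : i != j -> lie_eq (LieBr (LieE i) (LieF j)) LieZero
  | lie_serreE i j : i != j ->
      lie_eq (iter `|1 - cartan_entry i j|%N (LieBr (LieE i)) (LieE j)) LieZero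
  | lie_serreF i j : i != j ->
      lie_eq (iter `|1 - cartan_entry i j|%N (LieBr (LieF i)) (LieF j)) LieZero.

Inductive lie_homogeneous (Q : quiver) : lattice Q -> lie_term Q -> Prop :=
  | lie_homE i : lie_homogeneous (simple_root i) (LieE i)
  | lie_homF i : lie_homogeneous (- simple_root i) (LieF i)
  | lie_homH i : lie_homogeneous 0 (LieH i)
  | lie_hom0 al : lie_homogeneous al LieZero
  | lie_homD al x y : lie_homogeneous al x -> lie_homogeneous al y ->
      lie_homogeneous al (LieAdd x y)
  | lie_homZ al c x : lie_homogeneous al x -> lie_homogeneous al (LieScale c x)
  | lie_homBr al be x y : lie_homogeneous al x -> lie_homogeneous be y ->
      lie_homogeneous (al + be) (LieBr x y).

(* al is nonzero and the component of degree al of the Kac-Moody Lie algebra,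
   graded by the root lattice, is nonzero. *)
Definition is_root (Q : quiver) (al : lattice Q) : Prop :=
  al != 0 /\ exists x : lie_term Q, lie_homogeneous al x /\ ~ lie_eq x LieZero.

Definition reflection (Q : quiver) (i : vertex Q) (x : lattice Q) : lattice Q :=
  x - simple_root i *~ cartan_form (simple_root i) x.

(* Conjugate to a simple root under the Weyl group. *)
Definition weyl_conj_simple (Q : quiver) (al : lattice Q) : Prop :=
  exists (w : seq (vertex Q)) (i : vertex Q),
    al = foldr (@reflection Q) (simple_root i) w.

Definition imaginary_root (Q : quiver) (al : lattice Q) : Prop :=
  is_root al /\ ~ weyl_conj_simple al.

Definition components (Q : quiver) (S : {set vertex Q}) :
    {set {set vertex Q}} :=
  equivalence_partition
    (connect [rel i j | [&& i \in S, j \in S & adjacent i j]]) S.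

Definition condition_star (Q : quiver) (delta : dimvec Q) : Prop :=
  (forall i : vertex Q,
     cartan_form (simple_root i) (to_lattice delta) < 0) /\
  (forall C C' : {set vertex Q},
     C \in components (supp delta) -> C' \in components (supp delta) ->
     C != C' ->
     (exists i j, [/\ i \in C, j \in C' & adjacent i j]) \/
     (exists v, (exists2 i, i \in C & adjacent v i) /\
                (exists2 j, j \in C' & adjacent v j))).

(* A representation puts the row vectors of length d i at the vertex i; an
   arrow a acts by right multiplication. *)
Definition rep (Q : quiver) (K : fieldType) (d : dimvec Q) : Type :=
  forall a : arrow Q, 'M[K]_(d (src a), d (tgt a)).

Definition rep_iso (Q : quiver) (K : fieldType) (d : dimvec Q)
    (M N : rep K d) : Prop :=
  exists g : forall i : vertex Q, 'M[K]_(d i),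
    (forall i, g i \in unitmx) /\
    (forall a, M a *m g (tgt a) = g (src a) *m N a).

(* A family of subspaces is given by the row spaces of square matrices. *)
Definition subrep (Q : quiver) (K : fieldType) (d : dimvec Q) (M : rep K d)
    (U : forall i : vertex Q, 'M[K]_(d i)) : Prop :=
  forall a : arrow Q, (U (src a) *m M a <= U (tgt a))%MS.

Definition indecomposable (Q : quiver) (K : fieldType) (d : dimvec Q)
    (M : rep K d) : Prop :=
  d != 0 /\
  forall U W : forall i : vertex Q, 'M[K]_(d i),
    subrep M U -> subrep M W ->
    (forall i, (U i :&: W i)%MS = 0) ->
    (forall i, (U i + W i :=: 1%:M)%MS) ->
    (forall i, U i = 0) \/ (forall i, W i = 0).

Definition alg_closure (F : finFieldType) : countClosedFieldType :=
  projT1 (countable_algebraic_closure F).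

Definition alg_closure_in (F : finFieldType) : {rmorphism F -> alg_closure F} :=
  projT1 (projT2 (countable_algebraic_closure F)).

Definition abs_indecomposable (Q : quiver) (F : finFieldType) (d : dimvec Q)
    (M : rep F d) : Prop :=
  @indecomposable Q (alg_closure F) d
    (fun a => map_mx (alg_closure_in F) (M a)).

(* The number of isomorphism classes. *)
Definition num_abs_indecomposable (Q : quiver) (F : finFieldType)
    (d : dimvec Q) : nat :=
  let R := {dffun forall a : arrow Q, 'M[F]_(d (src a), d (tgt a))} in
  #|equivalence_partition (fun M N : R => `[< @rep_iso Q F d M N >])
      [set M : R | `[< @abs_indecomposable Q F d M >]]|.

Definition is_kac_polynomial (Q : quiver) (d : dimvec Q) (P : {poly rat}) :
    Prop :=
  forall F : finFieldType, P.[#|F|%:R] = (num_abs_indecomposable F d)%:R.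

(* The coefficient of q^(deg P - i), and 0 when i > deg P. *)
Definition top_coef (P : {poly rat}) (i : nat) : rat :=
  if (i < size P)%N then P`_((size P).-1 - i) else 0.

(* Formal power series, as coefficient sequences. *)
Definition fps := nat -> rat.

Definition fps_of_poly (P : {poly rat}) : fps := fun n => P`_n.

Definition fps_mul (f g : fps) : fps :=
  fun n => \sum_(k < n.+1) f k * g (n - k)%N.

(* Long division by a series g with g 0 != 0: the quotient h is determined by
   f n = \sum_(k < n.+1) h k * g (n - k).  fps_div_prefix lists h 0, ...,
   h n.-1. *)
Fixpoint fps_div_prefix (f g : fps) (n : nat) : seq rat :=
  if n is m.+1 then
    let s := fps_div_prefix f g m in
    rcons s ((f m - \sum_(k < m) s`_k * g (m - k)%N) / g 0%N)
  else [::].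

Definition fps_div (f g : fps) : fps :=
  fun n => (fps_div_prefix f g n.+1)`_n.

(* p^l(q) = prod_{m >= 1} (1 - q^m)^(-l); the factors with m > n do not affect
   the coefficient of q^n. *)
Definition colored_partition_series (l : nat) : fps := fun n =>
  fps_div (fps_of_poly 1)
    (fps_of_poly (\prod_(1 <= m < n.+1) (1 - 'X^m) ^+ l)) n.

(* Main.v *)
Require Import Defs.
From HB Require Import structures.
From mathcomp Require Import all_boot all_order all_algebra all_field.
From mathcomp Require Import boolp zify ring lra.
From Stdlib Require Import Setoid Morphisms.

(** Write [v] for [d + n delta], [t] for [1/q], and [rho] for the dimension
    [apair v v] of the space of representations of dimension [v].  For large [n]
    almost every such representation has only scalar endomorphisms, and the
    stable coefficients are those that would result if all of them had.

    The group [G_v] of base changes acts on representations, and counting the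
    pairs (automorphism [g] of [M], absolutely indecomposable [M]) orbit by
    orbit gives [A_v(q) |G_v|] ([sum_card_stab]).  The pairs in which [g] is
    scalar and [M] is arbitrary number [(q - 1) q^rho].  Since
    [|G_v|] is the product over [i] of [q^'C(v_i, 2) prod_(k <= v_i) (q^k - 1)],
    this main term contributes, read from the leading coefficient down,
    [(1 - t) / prod_i prod_(k <= v_i) (1 - t^k)].  The factors at the vertices
    of the support of [delta] tend to infinite products, whose inverses count
    partitions, and the other factors do not depend on [n].

    The error is governed by pairs [(phi, M)] where [phi] is an endomorphism of
    [M] that is either a nontrivial idempotent or a nonzero nilpotent.  Indeed,
    as [v] is indivisible, an endomorphism of a representation without
    nontrivial idempotent endomorphisms is a scalar plus a nilpotent
    ([endo_scalar_plus_nilpotent]), and a representation that is not absolutely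
    indecomposable has a nonscalar endomorphism already over the ground field
    ([decomposable_nonscalar_endo], [scalar_endo_descent]).  Restricting [phi]
    and [M] to the image of [phi] and iterating ([card_pairs_by_image]) bounds
    the number of these pairs by a constant times the sum, over the
    decompositions of [v] into at least two nonzero vectors [w], of
    [q^(rho + 1/2 sum_w (w, v - w))].

    It remains to see that [(w, v - w)] tends to minus infinity with [n],
    uniformly in [w] ([kac_bound]).  An inequality of Kac bounds it by
    [sum_i w_i (v_i - w_i) / v_i (e_i, v)], which suffices unless [w] and
    [v - w] have disjoint supports, because every [(e_i, v)] tends to minus
    infinity.  If the supports are disjoint, some edge between them has an end in
    the support of [delta], and it contributes at least [n] in absolute value:
    such an edge exists because every vertex outside the support of [delta] has a
    neighbour in it, and because this support is connected, as is the support of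
    any root ([root_support_connected]).

    So for every [m] and all large [n] the polynomial
    [A_v(q) |G_v| - (q - 1) q^rho] is bounded at all primes by a constant times
    [q^(rho + 1 - m)].  Hence it has degree at most [rho + 1 - m], and the first
    [m] coefficients of [A_v] are those of the main term
    ([stable_series_unique]). *)

Set Implicit Arguments.
Unset Strict Implicit.
Unset Printing Implicit Defensive.

Import Order.TTheory GRing.Theory Num.Theory.
Local Open Scope ring_scope.

(** * Representations and commuting endomorphisms *)

(** Families of matrices are finite functions rather than dependent products, so
    that they can be counted and collected into sets. *)
Definition vmaps (Q : quiver) (F : finFieldType) (v w : dimvec Q) :=
  {dffun forall i : vertex Q, 'M[F]_(v i, w i)}.
Definition amaps (Q : quiver) (F : finFieldType) (v w : dimvec Q) :=
  {dffun forall a : arrow Q, 'M[F]_(v (src a), w (tgt a))}.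

Definition vpair (Q : quiver) (v w : dimvec Q) : nat := (\sum_i v i * w i)%N.
Definition apair (Q : quiver) (v w : dimvec Q) : nat :=
  (\sum_(a : arrow Q) v (src a) * w (tgt a))%N.

Lemma dimvec_neq0 (Q : quiver) (v : dimvec Q) : v != 0 -> exists i, (0 < v i)%N.
Proof.
move=> v0; apply/existsP; apply: contraNT v0; rewrite negb_exists => /forallP H.
by apply/eqP/ffunP=> i; rewrite [RHS]ffunE; apply/eqP; rewrite -leqn0 leqNgt.
Qed.

Lemma card_dffun_mx (I : finType) (F : finFieldType) (m n : I -> nat) :
  #|{dffun forall i : I, 'M[F]_(m i, n i)}| = (#|F| ^ (\sum_i m i * n i))%N.
Proof.
rewrite card_dep_ffun foldrE big_image /= expn_sum.
apply: eq_bigr => i _; exact: card_mx.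
Qed.

Lemma ex_row_complement (F : fieldType) (r l n : nat) (B : 'M[F]_(r, n)) :
  row_free B -> (r + l = n)%N -> exists B' : 'M[F]_(l, n), row_full (col_mx B B').
Proof.
move=> /eqP rB e; have rc : \rank (B^C)%MS = l by rewrite mxrank_compl rB -e addKn.
exists (castmx (rc, erefl) (row_base (B^C)%MS)).
rewrite -sub1mx -addsmxE; have := addsmx_compl_full B; rewrite -sub1mx => H.
apply: submx_trans H _; apply: addsmxS => //.
by case: _ / rc; rewrite castmx_id eq_row_base.
Qed.

(** A chosen complement, so that it depends on [B] only and may serve to define
    coordinates. *)
Definition row_complement (F : finFieldType) (r l n : nat) (B : 'M[F]_(r, n)) :
  'M[F]_(l, n) := odflt 0 [pick B' | row_full (col_mx B B')].

Lemma row_complement_full (F : finFieldType) (r l n : nat) (B : 'M[F]_(r, n)) :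
  row_free B -> (r + l = n)%N -> row_full (col_mx B (row_complement l B)).
Proof.
move=> fB e; rewrite /row_complement; case: pickP => [B' //|no].
by have [B' fB'] := ex_row_complement fB e; rewrite no in fB'.
Qed.

Lemma ex_full_rank_factor (F : fieldType) (m n r : nat) (A : 'M[F]_(m, n)) :
  \rank A = r ->
  exists LB : 'M[F]_(m, r) * 'M[F]_(r, n),
    [/\ A = LB.1 *m LB.2, row_full LB.1 & row_free LB.2].
Proof.
move=> <-; exists (col_base A, row_base A); split=> /=.
- by rewrite mulmx_base.
- exact: col_base_full.
- exact: row_base_free.
Qed.

Definition commutes (Q : quiver) (K : fieldType) (v : dimvec Q)
    (phi : forall i, 'M[K]_(v i)) (M : rep K v) : Prop :=
  forall a : arrow Q, phi (src a) *m M a = M a *m phi (tgt a).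

Definition gl (Q : quiver) (F : finFieldType) (v : dimvec Q) : {set vmaps F v v} :=
  [set g : vmaps F v v | [forall i, g i \in unitmx]].

Definition full_rank_factor (Q : quiver) (F : finFieldType) (v r : dimvec Q)
    (phi : vmaps F v v) (L : vmaps F v r) (B : vmaps F r v) : Prop :=
  forall i, [/\ phi i = L i *m B i, row_full (L i) & row_free (B i)].

(** In a factorization [phi = L B] of full rank the rows of [B i] are a basis of
    the image of [phi i].  In these bases [image_endo] and [image_rep] are the
    restrictions of [phi] and [M] to the image. *)
Definition image_endo (Q : quiver) (F : finFieldType) (v r : dimvec Q)
    (L : vmaps F v r) (B : vmaps F r v) : vmaps F r r :=
  [ffun i => B i *m L i].

Definition image_rep (Q : quiver) (F : finFieldType) (v r : dimvec Q)
    (L : vmaps F v r) (M : amaps F v v) : amaps F r r :=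
  [ffun a => pinvmx (L (src a)) *m M a *m L (tgt a)].

Lemma full_rank_factor_exists (Q : quiver) (F : finFieldType) (v r : dimvec Q)
    (phi : vmaps F v v) : (forall i, \rank (phi i) = r i) ->
  exists LB : vmaps F v r * vmaps F r v, full_rank_factor phi LB.1 LB.2.
Proof.
move=> rk.
have [LB LBP] := fin_all_exists (fun i => ex_full_rank_factor (rk i)).
exists ([ffun i => (LB i).1], [ffun i => (LB i).2]) => i /=.
by rewrite !ffunE; have [-> fL fB] := LBP i; split.
Qed.

Lemma image_repP (Q : quiver) (F : finFieldType) (v r : dimvec Q)
    (phi : vmaps F v v) (M : amaps F v v) (L : vmaps F v r) (B : vmaps F r v) :
  commutes phi M -> full_rank_factor phi L B ->
  forall a, B (src a) *m M a = image_rep L M a *m B (tgt a) /\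
            M a *m L (tgt a) = L (src a) *m image_rep L M a.
Proof.
move=> comm fac a; rewrite ffunE.
have [e1 L1 B1] := fac (src a); have [e2 L2 B2] := fac (tgt a).
have BM : B (src a) *m M a = pinvmx (L (src a)) *m M a *m L (tgt a) *m B (tgt a).
  by rewrite -2!mulmxA -e2 -comm e1 !mulmxA mulVpmx // mul1mx.
split=> //.
apply: (row_free_inj B2) => /=.
by rewrite -[LHS]mulmxA -e2 -comm e1 -[LHS]mulmxA BM !mulmxA.
Qed.

(** A matrix is determined by its restriction to a subspace, its projection to a
    quotient, and the remaining block. *)
Lemma mx_eq_on_complements (F : fieldType) (m n r s l k : nat)
    (B : 'M[F]_(r, m)) (B' : 'M[F]_(l, m)) (L : 'M[F]_(n, s)) (L' : 'M[F]_(n, k))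
    (X Y : 'M[F]_(m, n)) :
  row_full (col_mx B B') -> row_free (row_mx L L') ->
  B *m X = B *m Y -> X *m L = Y *m L -> B' *m X *m L' = B' *m Y *m L' -> X = Y.
Proof.
move=> fB fL e1 e2 e3; apply: (row_free_inj fL) => /=; apply: (row_full_inj fB) => /=.
by rewrite !mul_mx_row e2 !mul_col_mx !mulmxA e1 e3.
Qed.

(** A pair is recovered from a basis [B] of the image of [phi], the restriction of
    the pair to this image, and two blocks: that of [phi] on a complement of the
    image, and that of [M] from a complement of the image to the kernel of
    [phi], since [M] is determined on the image and modulo the kernel.  The
    choices of [B] form a torsor under [gl F r], whence the factor on the
    left. *)
Lemma card_pairs_by_image (Q : quiver) (F : finFieldType) (v r l : dimvec Q)
    (A : {set vmaps F v v * amaps F v v}) (S : {set vmaps F r r * amaps F r r}) :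
  (forall i, r i + l i = v i)%N ->
  (forall p, p \in A -> commutes p.1 p.2 /\ forall i, \rank (p.1 i) = r i) ->
  (forall p L B, p \in A -> full_rank_factor p.1 L B ->
     (image_endo L B, image_rep L p.2) \in S) ->
  (#|A| * #|gl F r| <= #|F| ^ (vpair r v + vpair l r + apair l l) * #|S|)%N.
Proof.
move=> rl AP AS.
have ex p : exists LB : vmaps F v r * vmaps F r v,
    p \in A -> full_rank_factor p.1 LB.1 LB.2.
  have [pA|] := boolP (p \in A); last by exists ([ffun i => 0], [ffun i => 0]).
  by have [_ rk] := AP _ pA; have [LB LBP] := full_rank_factor_exists rk; exists LB.
have [LB LBP] := fin_all_exists ex.
pose B (p : vmaps F v v * amaps F v v) (g : vmaps F r r) : vmaps F r v :=
  [ffun i => g i *m (LB p).2 i].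
pose L (p : vmaps F v v * amaps F v v) (g : vmaps F r r) : vmaps F v r :=
  [ffun i => (LB p).1 i *m invmx (g i)].
pose Bc (B : vmaps F r v) : vmaps F l v := [ffun i => row_complement (l i) (B i)].
pose Lc (L : vmaps F v r) : vmaps F v l := [ffun i => (row_complement (l i) (L i)^T)^T].
have BcE B0 i : Bc B0 i = row_complement (l i) (B0 i) by rewrite ffunE.
have LcE L0 i : Lc L0 i = (row_complement (l i) (L0 i)^T)^T by rewrite ffunE.
have fac p g : p \in A -> g \in gl F r -> full_rank_factor p.1 (L p g) (B p g).
  move=> pA; rewrite inE => /forallP gu i; have [e fL fB] := LBP _ pA i.
  rewrite !ffunE; split.
  - by rewrite mulmxA mulmxKV // gu.
  - by rewrite /row_full mxrankMfree ?row_free_unit ?unitmx_inv ?gu.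
  - by rewrite /row_free eqmxMfull ?row_full_unit ?gu.
(* The rows of [Bc B] complement the image and the columns of [Lc L] complement
   those of [L], so the second and third entries are the two free blocks. *)
pose f (x : (vmaps F v v * amaps F v v) * vmaps F r r) :=
  let: (p, g) := x in
  (((B p g, [ffun i => Bc (B p g) i *m L p g i] : vmaps F l r),
    [ffun a => Bc (B p g) (src a) *m p.2 a *m Lc (L p g) (tgt a)] : amaps F l l),
   (image_endo (L p g) (B p g), image_rep (L p g) p.2)).
rewrite -cardsX.
have finj : {in setX A (gl F r) &, injective f}.
  move=> [p g] [p' g']; rewrite !in_setX /= => /andP[pA gG] /andP[pA' gG'] [eB eBL eM ephi eM'].
  have F1 := fac _ _ pA gG; have F2 := fac _ _ pA' gG'.
  have [c1 _] := AP _ pA; have [c2 _] := AP _ pA'.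
  have fcB i : row_full (col_mx (B p g i) (Bc (B p g) i)).
    by rewrite BcE; apply: row_complement_full => //; case: (F1 i).
  have eL : L p g = L p' g'.
    apply/ffunP=> i; apply: (row_full_inj (fcB i)) => /=; rewrite !mul_col_mx.
    move/ffunP/(_ i): eBL; rewrite !(ffunE (fun i => Bc _ i *m _)) eB => ->.
    by move/ffunP/(_ i): ephi; rewrite !(ffunE (fun i => B _ _ i *m _)) eB => ->.
  have fcL i : row_free (row_mx (L p g i) (Lc (L p g) i)).
    have [_ fL _] := F1 i.
    rewrite LcE -[row_mx _ _]trmxK tr_row_mx trmxK /row_free mxrank_tr.
    by apply: row_complement_full => //; rewrite /row_free mxrank_tr.
  have eM0 : p.2 = p'.2.
    apply/ffunP=> a.
    have [b1 b2] := image_repP c1 F1 a; have [b3 b4] := image_repP c2 F2 a.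
    apply: (mx_eq_on_complements (fcB (src a)) (fcL (tgt a))).
    - by rewrite b1 eM' eB b3.
    - by rewrite b2 eM' eL b4.
    - by move/ffunP/(_ a): eM; rewrite !(ffunE (fun a => Bc _ _ *m _ *m _)) -eB -eL.
  have ep : p = p'.
    rewrite (surjective_pairing p) (surjective_pairing p') eM0; congr (_, _).
    apply/ffunP=> i; have [-> _ _] := F1 i; have [-> _ _] := F2 i.
    by rewrite eB eL.
  rewrite -ep in eB *; congr (_, _); apply/ffunP=> i.
  have [_ _ fB] := LBP _ pA i; move/ffunP/(_ i): eB; rewrite !ffunE.
  exact: row_free_inj.
rewrite -(card_in_imset finj).
apply: leq_trans (_ : #|setX [set: (vmaps F r v * vmaps F l r * amaps F l l)%type] S| <= _)%N.
  apply/subset_leq_card/subsetP=> y /imsetP[[p g]]; rewrite in_setX /= => /andP[pA gG] ->.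
  by rewrite in_setX inE /=; apply: AS => //; apply: fac.
by rewrite cardsX cardsT !card_prod !card_dffun_mx !expnD.
Qed.

(** * The general linear group, nilpotent and idempotent endomorphisms *)

Definition gl_order (Q : quiver) (v : dimvec Q) (q : nat) : nat :=
  (\prod_i (q ^ 'C(v i, 2) * \prod_(1 <= k < (v i).+1) (q ^ k - 1)))%N.

Lemma card_unitmx (F : finFieldType) (n : nat) :
  #|[set g : 'M[F]_n | g \in unitmx]| =
  (#|F| ^ 'C(n, 2) * \prod_(1 <= k < n.+1) (#|F| ^ k - 1))%N.
Proof.
case: n => [|n].
  rewrite big_nil muln1 expn0; apply/eqP/cards1P; exists 0.
  by apply/setP=> g; rewrite !inE (flatmx0 g) eqxx unitmxE det_mx00 unitr1.
rewrite -(card_GL F (ltn0Sn n)) [RHS]cardsT /= card_sub.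
by apply: eq_card => g; rewrite inE.
Qed.

Lemma card_gl (Q : quiver) (F : finFieldType) (v : dimvec Q) :
  #|gl F v| = gl_order v #|F|.
Proof.
have := card_family (fun i => pred_of_simpl [pred g : 'M[F]_(v i) | g \in unitmx]).
rewrite foldrE big_image /= => H; rewrite /gl cardsE.
transitivity (\prod_i #|[pred g : 'M[F]_(v i) | g \in unitmx]|)%N.
  by rewrite -[RHS]H; apply: eq_card.
apply: eq_bigr => i _; rewrite -card_unitmx.
by apply: eq_card => g; rewrite inE.
Qed.

(** Each factor satisfies [q ^ k <= 2 (q ^ k - 1)]. *)
Lemma gl_order_lb (Q : quiver) (v : dimvec Q) (q : nat) : (1 < q)%N ->
  (q ^ vpair v v <= 2 ^ (\sum_i v i) * gl_order v q)%N.
Proof.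
move=> q1; rewrite /vpair /gl_order !expn_sum -big_split /=.
apply: leq_prod => i _.
have -> : (v i * v i = 'C(v i, 2) + \sum_(1 <= k < (v i).+1) k)%N.
  elim: (v i) => [|n IH]; first by rewrite big_nil.
  by rewrite big_nat_recr //= binS bin1; lia.
rewrite mulnCA expnD leq_pmul2l ?expn_gt0 ?(ltnW q1) // expn_sum.
elim: (v i) => [|n IH]; first by rewrite !big_nil.
rewrite big_nat_recr //= (big_nat_recr _ _ (fun k => q ^ k - 1)%N) //=.
rewrite [(2 ^ n.+1)%N]expnS [(2 * _)%N]mulnC mulnACA leq_mul //.
have : (2 <= q ^ n.+1)%N by rewrite (leq_trans q1) // -[leqLHS]expn1 leq_exp2l.
by lia.
Qed.

Definition nilpotent_mx (K : fieldType) (n : nat) (A : 'M[K]_n) : Prop :=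
  exists k : nat, A ^+ k = 0.

Definition nilpotent_pairs (Q : quiver) (F : finFieldType) (v : dimvec Q) :
    {set vmaps F v v * amaps F v v} :=
  [set p : vmaps F v v * amaps F v v | `[< commutes p.1 p.2 /\ forall i, nilpotent_mx (p.1 i) >]].

Definition idempotent_pairs (Q : quiver) (F : finFieldType) (v : dimvec Q) :
    {set vmaps F v v * amaps F v v} :=
  [set p : vmaps F v v * amaps F v v | `[< commutes p.1 p.2 /\ forall i, p.1 i *m p.1 i = p.1 i >]].

Lemma nilpotent_mx_lt (K : fieldType) (n : nat) (A : 'M[K]_n) :
  nilpotent_mx A -> (0 < n)%N -> (\rank A < n)%N.
Proof.
case=> k Ak n0; rewrite ltn_neqAle rank_leq_row andbT; apply/negP=> fA.
have uA : A \in unitmx by rewrite -row_free_unit.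
case: n n0 A Ak fA uA => // n _ A Ak fA uA.
have : A ^+ k \in unitmx by exact: unitrX.
by rewrite Ak unitr0.
Qed.

Lemma expmx_comm (K : fieldType) (m n : nat) (A : 'M[K]_m) (B : 'M[K]_n) (X : 'M[K]_(m, n)) k :
  A *m X = X *m B -> A ^+ k *m X = X *m B ^+ k.
Proof.
move=> e; elim: k => [|k IH]; first by rewrite !expr0 mul1mx mulmx1.
by rewrite !exprS -!mulmxE -mulmxA IH mulmxA e mulmxA.
Qed.

(** If [phi = L B] then [(B L)^(k+1) = B phi^k L]. *)
Lemma nilpotent_pairs_image (Q : quiver) (F : finFieldType) (v r : dimvec Q)
    p (L : vmaps F v r) (B : vmaps F r v) :
  p \in nilpotent_pairs F v -> full_rank_factor p.1 L B ->
  (image_endo L B, image_rep L p.2) \in nilpotent_pairs F r.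
Proof.
rewrite !inE => /asboolP[comm nil] fac; apply/asboolP; split=> [a|i] /=.
  have [e1 e2] := image_repP comm fac a.
  by rewrite [image_endo L B _]ffunE [image_endo L B _]ffunE -mulmxA -e2 !mulmxA e1.
have [k nk] := nil i; have [e fL fB] := fac i.
exists k.+1; rewrite ffunE exprSr -mulmxE mulmxA.
rewrite (@expmx_comm _ _ _ _ (p.1 i)); last by rewrite e mulmxA.
by rewrite nk mulmx0 mul0mx.
Qed.

(** An idempotent is the identity on its image. *)
Lemma idempotent_pairs_image (Q : quiver) (F : finFieldType) (v r : dimvec Q)
    p (L : vmaps F v r) (B : vmaps F r v) :
  p \in idempotent_pairs F v -> full_rank_factor p.1 L B ->
  image_endo L B = [ffun i => 1%:M].
Proof.
rewrite !inE => /asboolP[comm idem] fac; apply/ffunP=> i; rewrite !ffunE.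
have [e fL fB] := fac i; have := idem i; rewrite e => H.
apply: (row_full_inj fL); apply: (row_free_inj fB) => /=.
by rewrite mulmx1 -[RHS]H !mulmxA.
Qed.

(** * Bounds that are uniform in the field *)

Lemma dimvecD (Q : quiver) (v w : dimvec Q) i : (v + w) i = (v i + w i)%N.
Proof. by rewrite ffunE. Qed.

Lemma vpairC (Q : quiver) (v w : dimvec Q) : vpair v w = vpair w v.
Proof. by apply: eq_bigr => i _; rewrite mulnC. Qed.

Lemma vpairDl (Q : quiver) (u v w : dimvec Q) : vpair (u + v) w = (vpair u w + vpair v w)%N.
Proof. by rewrite /vpair -big_split; apply: eq_bigr => i _; rewrite dimvecD mulnDl. Qed.

Lemma vpairDr (Q : quiver) (u v w : dimvec Q) : vpair w (u + v) = (vpair w u + vpair w v)%N.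
Proof. by rewrite !(vpairC w) vpairDl. Qed.

(** Iterating the passage to the image cuts [v] into parts, the codimensions of
    the successive images.  The pairs that give the parts [s] number about
    [q ^ (vpair v v + sum_w (apair w w - vpair w w))], and [B] bounds these
    exponents over all [s] with at least [k] parts. *)
Definition decomposition_bound (Q : quiver) (k : nat) (v : dimvec Q) (B : nat) : Prop :=
  forall s : seq (dimvec Q), (k <= size s)%N -> 0 \notin s -> \sum_(w <- s) w = v ->
    (vpair v v + \sum_(w <- s) apair w w <= B + \sum_(w <- s) vpair w w)%N.

Definition uniformly_bounded (X : finFieldType -> nat) (B : nat) : Prop :=
  exists C : nat, forall F : finFieldType, (X F <= C * #|F| ^ B)%N.

(** The vector [l] becomes the first part, and the decompositions of the image
    [r] supply the others.  What is subtracted is the exponent of the choices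
    that extend a pair from the image. *)
Lemma decomposition_bound_sub (Q : quiver) (k : nat) (v r l : dimvec Q) (B : nat) :
  decomposition_bound k v B -> r + l = v -> l != 0 -> (k <= 1 + (r != 0%R))%N ->
  (2 * vpair l r + apair l l <= B)%N /\
  decomposition_bound 0 r (B - (2 * vpair l r + apair l l)).
Proof.
move=> dB rl l0 kr.
have key (s : seq (dimvec Q)) : 0 \notin s -> \sum_(w <- s) w = r ->
    (vpair r r + 2 * vpair l r + apair l l + \sum_(w <- s) apair w w
       <= B + \sum_(w <- s) vpair w w)%N.
  move=> s0 sr; have := dB (l :: s).
  rewrite inE negb_or eq_sym l0 s0 !big_cons sr addrC rl => H.
  have {}H := H _ isT erefl; rewrite -rl vpairDl !vpairDr (vpairC r l) in H.
  suff ks : (k <= size (l :: s))%N by have {}H := H ks; lia.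
  apply: leq_trans kr _; rewrite /= leq_add2l.
  case: s sr {s0 H} => [|w s'] /=; first by rewrite big_nil => <-; rewrite eqxx.
  by case: (r != 0).
have B0 : (2 * vpair l r + apair l l <= B)%N.
  have [r0|r0] := eqVneq r 0.
    by have := key [::] isT; rewrite !big_nil r0 => /(_ erefl); lia.
  have := key [:: r]; rewrite inE eq_sym r0 !big_seq1 => /(_ isT erefl); lia.
split=> // s _ s0 sr; have := key s s0 sr; lia.
Qed.

(** Dividing by [#|gl F r|] lowers the exponent by [vpair r r], at the cost of a
    constant. *)
Lemma stratum_bound (Q : quiver) (r : dimvec Q) (A S : finFieldType -> nat) (e b B : nat) :
  (forall F : finFieldType, (A F * #|gl F r| <= #|F| ^ e * S F)%N) ->
  uniformly_bounded S b -> (e + b <= vpair r r + B)%N -> uniformly_bounded A B.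
Proof.
move=> AS [C CS] eb; exists (2 ^ (\sum_i r i) * C)%N => F.
have q1 := finNzRing_gt1 F.
have q0 : (0 < #|F| ^ vpair r r)%N by rewrite expn_gt0 ltnW.
rewrite -(leq_pmul2l q0) mulnC.
apply: leq_trans (_ : A F * (2 ^ (\sum_i r i) * #|gl F r|) <= _)%N.
  by rewrite leq_mul2l card_gl gl_order_lb ?orbT.
rewrite -(mulnA (2 ^ _)%N) [leqLHS]mulnCA [leqRHS]mulnCA leq_mul2l; apply/orP; right.
apply: leq_trans (AS F) _.
apply: leq_trans (_ : #|F| ^ e * (C * #|F| ^ b) <= _)%N; first by rewrite leq_mul2l CS orbT.
by rewrite [leqLHS]mulnCA [leqRHS]mulnCA leq_mul2l -!expnD leq_exp2l // eb orbT.
Qed.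

Lemma uniformly_bounded_sum (I : finType) (X : I -> finFieldType -> nat) (B : nat) :
  (forall i, uniformly_bounded (X i) B) ->
  uniformly_bounded (fun F => (\sum_i X i F)%N) B.
Proof.
move=> /fin_all_exists[C CX]; exists (\sum_i C i)%N => F.
by rewrite big_distrl leq_sum.
Qed.

Lemma uniformly_bounded_le (X Y : finFieldType -> nat) (B : nat) :
  (forall F, (X F <= Y F)%N) -> uniformly_bounded Y B -> uniformly_bounded X B.
Proof. by move=> XY [C CY]; exists C => F; apply: leq_trans (XY F) (CY F). Qed.

Definition rank_stratum (Q : quiver) (F : finFieldType) (v r : dimvec Q)
    (X : {set vmaps F v v * amaps F v v}) : {set vmaps F v v * amaps F v v} :=
  [set p in X | [forall i, \rank (p.1 i) == r i]].

(** The possible ranks are finite in number and do not depend on the field. *)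
Lemma rank_strata_bound (Q : quiver) (v : dimvec Q) (B : nat)
    (X : forall F : finFieldType, {set vmaps F v v * amaps F v v}) :
  (forall r l : dimvec Q, r + l = v ->
     uniformly_bounded (fun F => #|rank_stratum r (X F)|) B) ->
  uniformly_bounded (fun F => #|X F|) B.
Proof.
move=> H; pose m := (\sum_i v i)%N.
pose vec (r : {ffun vertex Q -> 'I_m.+1}) : dimvec Q := [ffun i => r i : nat].
have vm i : (v i <= m)%N by rewrite /m (bigD1 i) //= leq_addr.
apply: (@uniformly_bounded_le _ (fun F =>
  (\sum_(r : {ffun vertex Q -> 'I_m.+1}) #|rank_stratum (vec r) (X F)|)%N)).
  move=> F; rewrite -sum1_card.
  pose f (p : vmaps F v v * amaps F v v) : {ffun vertex Q -> 'I_m.+1} :=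
    [ffun i => inord (\rank (p.1 i))].
  rewrite (partition_big f xpredT) //=; apply: leq_sum => r _.
  rewrite sum1_card; apply/subset_leq_card/subsetP => p.
  rewrite !inE => /andP[-> /eqP <-] /=; apply/forallP=> i.
  by rewrite !ffunE inordK // ltnS (leq_trans (rank_leq_row _)).
apply: uniformly_bounded_sum => r.
have [rv|] := boolP [forall i, (r i <= v i)%N].
  apply: (H _ [ffun i => v i - r i]%N); apply/ffunP=> i.
  by rewrite dimvecD !ffunE subnKC // (forallP rv).
rewrite negb_forall => /existsP[i ri]; exists 0%N => F.
rewrite mul0n leqn0 cards_eq0; apply/eqP/setP=> p; rewrite !inE; apply/negbTE.
apply/negP=> /andP[_ /forallP/(_ i)]; rewrite ffunE => /eqP e.
by rewrite -e rank_leq_row in ri.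
Qed.

(** * Counting pairs with a nilpotent or idempotent endomorphism *)

Lemma rank_stratumP (Q : quiver) (F : finFieldType) (v r : dimvec Q)
    (X : {set vmaps F v v * amaps F v v}) p :
  p \in rank_stratum r X -> p \in X /\ forall i, \rank (p.1 i) = r i.
Proof. by rewrite inE => /andP[-> /forallP H]; split=> // i; apply/eqP. Qed.

Lemma vpair_image_exponent (Q : quiver) (v r l : dimvec Q) (b : nat) :
  r + l = v ->
  (vpair r v + vpair l r + apair l l + b =
   vpair r r + (2 * vpair l r + apair l l + b))%N.
Proof. by move=> <-; rewrite vpairDr (vpairC r l); lia. Qed.

Lemma nilpotent_stratum_bound (Q : quiver) (v r l : dimvec Q) (b B : nat) :
  r + l = v -> (2 * vpair l r + apair l l + b <= B)%N ->
  uniformly_bounded (fun F => #|nilpotent_pairs F r|) b ->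
  uniformly_bounded (fun F => #|rank_stratum r (nilpotent_pairs F v)|) B.
Proof.
move=> rl bB nb.
apply: (@stratum_bound _ r _ _ (vpair r v + vpair l r + apair l l) b B _ nb).
  move=> F; apply: card_pairs_by_image => [i|p|p L M].
  - by rewrite -rl dimvecD.
  - by move=> /rank_stratumP[]; rewrite inE => /asboolP[].
  - by move=> /rank_stratumP[pN _]; apply: nilpotent_pairs_image.
by rewrite vpair_image_exponent // leq_add2l.
Qed.

Lemma nilpotent_stratum_full (Q : quiver) (F : finFieldType) (v : dimvec Q) :
  v != 0 -> rank_stratum v (nilpotent_pairs F v) = set0.
Proof.
move=> v0; apply/setP=> p; rewrite [RHS]inE; apply/negP=> /rank_stratumP[].
rewrite inE => /asboolP[_ nil] rk; case/negP: v0; apply/eqP/ffunP=> i.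
rewrite [RHS]ffunE; apply/eqP; rewrite -leqn0 leqNgt; apply/negP=> vi.
by have := nilpotent_mx_lt (nil i) vi; rewrite rk ltnn.
Qed.

Lemma dimvec_sum_lt (Q : quiver) (v r l : dimvec Q) :
  r + l = v -> l != 0 -> (\sum_i r i < \sum_i v i)%N.
Proof.
move=> <- l0; have -> : (\sum_i (r + l)%R i = \sum_i r i + \sum_i l i)%N.
  by rewrite -big_split; apply: eq_bigr => i _; rewrite dimvecD.
rewrite -[ltnLHS]addn0 ltn_add2l lt0n; apply: contra l0; rewrite sum_nat_eq0.
by move=> /forallP H; apply/eqP/ffunP=> i; rewrite [RHS]ffunE; apply/eqP/H.
Qed.

Lemma uniformly_bounded0 (X : finFieldType -> nat) (B : nat) :
  (forall F, X F = 0)%N -> uniformly_bounded X B.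
Proof. by move=> X0; exists 0%N => F; rewrite X0. Qed.

(** The image of a nilpotent endomorphism of a nonzero space is a proper subspace
    on which the endomorphism is again nilpotent, so induction applies. *)
Lemma nilpotent_pairs_bound (Q : quiver) (v : dimvec Q) (B : nat) :
  decomposition_bound 0 v B -> uniformly_bounded (fun F => #|nilpotent_pairs F v|) B.
Proof.
have [n] := ubnP (\sum_i v i)%N; elim: n v B => // n IH v B vn dB.
have [v0|v0] := eqVneq v 0.
  apply: (@uniformly_bounded_le _ (fun F => 1)%N); last first.
    by exists 1%N => F; rewrite mul1n expn_gt0 ltnW // finNzRing_gt1.
  move=> F; apply: leq_trans (max_card _) _.
  rewrite card_prod !card_dffun_mx !big1 ?expn0 // => i _; by rewrite v0 ffunE.
apply: rank_strata_bound => r l rl.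
have [l0|l0] := eqVneq l 0.
  have -> : r = v by rewrite -rl l0 addr0.
  by apply: uniformly_bounded0 => F; rewrite nilpotent_stratum_full // cards0.
have [bB dr] := decomposition_bound_sub dB rl l0 isT.
apply: (nilpotent_stratum_bound rl _ (IH _ _ _ dr)); first by rewrite subnKC.
by apply: leq_trans (dimvec_sum_lt rl l0) _.
Qed.

Definition nonzero_nilpotent_pairs (Q : quiver) (F : finFieldType) (v : dimvec Q) :=
  [set p in nilpotent_pairs F v | [exists i, p.1 i != 0]].

Definition nontrivial_idempotent_pairs (Q : quiver) (F : finFieldType) (v : dimvec Q) :=
  [set p in idempotent_pairs F v |
     [exists i, p.1 i != 0] && [exists i, p.1 i != 1%:M]].

(** A nonzero nilpotent endomorphism has a proper nonzero image, so at least two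
    parts occur. *)
Lemma nonzero_nilpotent_pairs_bound (Q : quiver) (v : dimvec Q) (B : nat) :
  decomposition_bound 2 v B ->
  uniformly_bounded (fun F => #|nonzero_nilpotent_pairs F v|) B.
Proof.
move=> dB; apply: rank_strata_bound => r l rl.
have sub F : (#|rank_stratum r (nonzero_nilpotent_pairs F v)| <=
              #|rank_stratum r (nilpotent_pairs F v)|)%N.
  apply/subset_leq_card/subsetP => p; rewrite inE => /andP[].
  by rewrite inE => /andP[pN _] rk; rewrite inE pN.
have [r0|r0] := eqVneq r 0.
  apply: uniformly_bounded0 => F; apply/eqP; rewrite cards_eq0; apply/eqP/setP=> p.
  rewrite [RHS]inE; apply/negP=> /rank_stratumP[]; rewrite inE => /andP[_ /existsP[i /eqP]].
  by move=> p0 rk; apply: p0; apply/eqP; rewrite -mxrank_eq0 rk r0 ffunE.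
have [l0|l0] := eqVneq l 0.
  have e : r = v by rewrite -rl l0 addr0.
  have v0 : v != 0 by rewrite -rl l0 addr0.
  apply: uniformly_bounded0 => F; apply/eqP; rewrite -leqn0.
  by apply: leq_trans (sub F) _; rewrite e nilpotent_stratum_full // cards0.
apply: uniformly_bounded_le sub _.
have [|bB dr] := decomposition_bound_sub dB rl l0; first by rewrite r0.
by apply: (nilpotent_stratum_bound rl _ (nilpotent_pairs_bound dr)); rewrite subnKC.
Qed.

(** On the image the endomorphism is the identity, so the only freedom there is the
    representation; the parts are the image and the kernel. *)
Lemma nontrivial_idempotent_pairs_bound (Q : quiver) (v : dimvec Q) (B : nat) :
  decomposition_bound 2 v B ->
  uniformly_bounded (fun F => #|nontrivial_idempotent_pairs F v|) B.
Proof.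
move=> dB; apply: rank_strata_bound => r l rl.
have [r0|r0] := eqVneq r 0.
  apply: uniformly_bounded0 => F; apply/eqP; rewrite cards_eq0; apply/eqP/setP=> p.
  rewrite [RHS]inE; apply/negP=> /rank_stratumP[].
  rewrite inE => /andP[_ /andP[/existsP[i /eqP p0] _]] rk.
  by apply: p0; apply/eqP; rewrite -mxrank_eq0 rk r0 ffunE.
have [l0|l0] := eqVneq l 0.
  apply: uniformly_bounded0 => F; apply/eqP; rewrite cards_eq0; apply/eqP/setP=> p.
  rewrite [RHS]inE; apply/negP=> /rank_stratumP[].
  rewrite inE => /andP[pI /andP[_ /existsP[i /eqP p1]]] rk; apply: p1.
  move: pI; rewrite inE => /asboolP[_ /(_ i) e].
  have f : row_free (p.1 i) by rewrite /row_free rk -rl l0 addr0.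
  by apply: (row_free_inj f) => /=; rewrite e mul1mx.
pose S F := setX [set [ffun i => 1%:M] : vmaps F r r] [set: amaps F r r].
apply: (@stratum_bound _ r _ (fun F => #|S F|) (vpair r v + vpair l r + apair l l)
         (apair r r)).
- move=> F; apply: card_pairs_by_image => [i|p|p L M].
  + by rewrite -rl dimvecD.
  + by move=> /rank_stratumP[]; rewrite !inE => /andP[/asboolP[]].
  + move=> /rank_stratumP[]; rewrite inE => /andP[pN _] _ fac.
    by rewrite in_setX /= (idempotent_pairs_image pN fac) !inE eqxx.
- by exists 1%N => F; rewrite cardsX cards1 cardsT card_dffun_mx.
rewrite vpair_image_exponent // leq_add2l.
have := dB [:: l; r] isT; rewrite !inE negb_or !(eq_sym 0) l0 r0 !big_cons !big_nil.
rewrite !addr0 addrC rl => /(_ isT erefl); rewrite -rl vpairDl !vpairDr (vpairC r l); lia.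
Qed.

(** * Polynomials in a matrix *)

(** The size 0 is a separate case because a vertex may carry the zero space,
    whose endomorphism ring is trivial. *)
Definition mxhorner (K : fieldType) (n : nat) : 'M[K]_n -> {poly K} -> 'M[K]_n :=
  if n is m.+1 return 'M[K]_n -> {poly K} -> 'M[K]_n
  then fun A p => horner_mx A p else fun A p => 0.

Lemma mx0_eq (K : fieldType) (n : nat) (A B : 'M[K]_(0, n)) : A = B.
Proof. by rewrite (flatmx0 A) (flatmx0 B). Qed.

Lemma mxhornerD (K : fieldType) (n : nat) (A : 'M[K]_n) p q :
  mxhorner A (p + q) = mxhorner A p + mxhorner A q.
Proof. by case: n A => [|n] A; [exact: mx0_eq | exact: rmorphD]. Qed.

Lemma mxhornerM (K : fieldType) (n : nat) (A : 'M[K]_n) p q :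
  mxhorner A (p * q) = mxhorner A p *m mxhorner A q.
Proof. by case: n A => [|n] A; [exact: mx0_eq | exact: rmorphM]. Qed.

Lemma mxhornerX (K : fieldType) (n : nat) (A : 'M[K]_n) : mxhorner A 'X = A.
Proof. by case: n A => [|n] A; [exact: mx0_eq | exact: horner_mx_X]. Qed.

Lemma mxhornerC (K : fieldType) (n : nat) (A : 'M[K]_n) c : mxhorner A c%:P = c%:M.
Proof. by case: n A => [|n] A; [exact: mx0_eq | exact: horner_mx_C]. Qed.

Lemma mxhorner_char (K : fieldType) (n : nat) (A : 'M[K]_n) : mxhorner A (char_poly A) = 0.
Proof. by case: n A => [|n] A; [exact: mx0_eq | exact: Cayley_Hamilton]. Qed.

Lemma mxhorner_comm (K : fieldType) (m n : nat) (A : 'M[K]_m) (B : 'M[K]_n)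
    (X : 'M[K]_(m, n)) (p : {poly K}) :
  A *m X = X *m B -> mxhorner A p *m X = X *m mxhorner B p.
Proof.
move=> e; elim/poly_ind: p => [|p c IH]; first by rewrite -polyC0 !mxhornerC scalar_mxC.
rewrite !mxhornerD !mxhornerM !mxhornerX !mxhornerC mulmxDl mulmxDr scalar_mxC.
by rewrite -mulmxA e mulmxA IH mulmxA.
Qed.

Lemma mxhornerXn (K : fieldType) (n : nat) (A : 'M[K]_n) p k :
  mxhorner A (p ^+ k) = mxhorner A p ^+ k.
Proof.
elim: k => [|k IH]; first by rewrite !expr0 -polyC1 mxhornerC.
by rewrite !exprS mxhornerM IH.
Qed.

Lemma dvdp_mxhorner0 (K : fieldType) (n : nat) (A : 'M[K]_n) p q :
  p %| q -> mxhorner A p = 0 -> mxhorner A q = 0.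
Proof. by move=> /dvdpP[r ->] p0; rewrite mxhornerM p0 mulmx0. Qed.

Lemma mxhorner_eigen (K : fieldType) (n : nat) (A : 'M[K]_n) p (x : 'rV[K]_n) c :
  x *m A = c *: x -> x *m mxhorner A p = p.[c] *: x.
Proof.
move=> e; have := @mxhorner_comm _ _ _ c%:M A x p.
rewrite mul_scalar_mx e => /(_ erefl) <-.
rewrite -mul_scalar_mx; congr (_ *m _).
elim/poly_ind: p => [|p d IH]; first by rewrite -polyC0 mxhornerC hornerC.
by rewrite mxhornerD mxhornerM mxhornerX mxhornerC IH !hornerE -scalar_mxM -raddfD.
Qed.

Lemma map_mxhorner (K L : fieldType) (f : {rmorphism K -> L}) (n : nat) (A : 'M[K]_n) p :
  map_mx f (mxhorner A p) = mxhorner (map_mx f A) (map_poly f p).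
Proof. by case: n A => [|n] A; [exact: mx0_eq | exact: map_horner_mx]. Qed.

(** Over an algebraic closure every eigenvalue of [A] is a root of [p].  Hence
    every nonconstant factor of the characteristic polynomial shares a root with
    [p], so is divisible by [p], and the characteristic polynomial is a power of
    [p] up to a constant. *)
Lemma irreducible_annihilator_dvd (F : finFieldType) (n N : nat) (A : 'M[F]_n)
    (p : {poly F}) : irreducible_poly p -> mxhorner A p ^+ N = 0 ->
  ((size p).-1 %| n)%N.
Proof.
move=> [p1 irr] pA; pose f := alg_closure_in F.
suff H m (g : {poly F}) : (size g <= m)%N -> g %| char_poly A -> ((size p).-1 %| (size g).-1)%N.
  by have := H _ _ (leqnn _) (dvdpp _); rewrite size_char_poly.
elim: m g => [|m IH] g sg gA.
  by move: sg; rewrite leqn0 size_poly_eq0 => /eqP->; rewrite size_poly0 dvdn0.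
have [g1|g1] := leqP (size g) 1; first by have -> : (size g).-1 = 0%N by lia.
have /closed_rootP[c gc] : size (map_poly f g) != 1%N by rewrite size_map_poly neq_ltn g1 orbT.
have ev : eigenvalue (map_mx f A) c.
  rewrite eigenvalue_root_char -map_char_poly.
  by move: gA => /dvdpP[h ->]; rewrite rmorphM rootM gc orbT.
have [x xe x0] := eigenvalueP ev.
have pc : root (map_poly f p) c.
  have : x *m mxhorner (map_mx f A) (map_poly f p ^+ N) = 0.
    by rewrite -rmorphXn -map_mxhorner mxhornerXn pA map_mx0 mulmx0.
  rewrite (mxhorner_eigen _ xe) => /eqP; rewrite scaler_eq0 (negPf x0) orbF horner_exp.
  by rewrite expf_eq0 => /andP[_ ?].
have ncop : ~~ coprimep p g.
  rewrite -(coprimep_map f); apply/negP=> /coprimep_root/(_ pc).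
  by move: gc; rewrite /root => ->.
have gp : p %| g.
  have := irr (gcdp p g); rewrite -coprimep_def ncop dvdp_gcdl => /(_ isT isT).
  by rewrite /eqp => /andP[_ /dvdp_trans]; apply; apply: dvdp_gcdr.
have [h eg] : exists h : {poly F}, g = h * p by apply/dvdpP.
have hA : h %| char_poly A by apply: dvdp_trans gA; rewrite eg dvdp_mulr.
have g0 : g != 0 by rewrite -size_poly_gt0 ltnW.
have [h0 p0] : h != 0 /\ p != 0 by apply/andP; rewrite -negb_or -mulf_eq0 -eg.
have sgE : size g = (size h + size p).-1 by rewrite eg size_mul.
have h0' : (0 < size h)%N by rewrite size_poly_gt0.
have p1' : (1 < size p)%N by [].
have -> : ((size g).-1 = (size h).-1 + (size p).-1)%N by lia.
by rewrite dvdn_add // IH //; lia.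
Qed.

(** * Endomorphisms of representations of indivisible dimension *)

Definition no_nontrivial_idempotent (Q : quiver) (K : fieldType) (v : dimvec Q)
    (M : rep K v) : Prop :=
  forall e : forall i, 'M[K]_(v i), commutes e M -> (forall i, e i *m e i = e i) ->
    (forall i, e i = 0) \/ (forall i, e i = 1%:M).

Lemma expmxD (K : fieldType) (n : nat) (A : 'M[K]_n) a b : A ^+ (a + b) = A ^+ a *m A ^+ b.
Proof. exact: exprD. Qed.

(** Among the powers of an element of a finite monoid there is an idempotent.  All
    the matrices are treated at once so that the exponent is common. *)
Lemma ex_idempotent_power (I : finType) (F : finFieldType) (n : I -> nat)
    (phi : forall i, 'M[F]_(n i)) :
  exists2 N, (0 < N)%N & forall i, phi i ^+ N *m phi i ^+ N = phi i ^+ N.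
Proof.
pose T : finType := {dffun forall i : I, 'M[F]_(n i)}.
pose pw (k : nat) : T := [ffun i => phi i ^+ k].
have pwE k i : pw k i = phi i ^+ k by rewrite ffunE.
have /injectivePn[a [b ab eab]] : ~~ injectiveb (fun k : 'I_#|T|.+1 => pw k).
  by apply/negP=> /injectiveP/leq_card; rewrite card_ord ltnn.
wlog lt_ab : a b ab eab / (a < b)%N.
  move=> H; case: (ltngtP a b) => [|ba|/val_inj e]; first exact: H.
    by apply: (H b a) => //; rewrite eq_sym.
  by rewrite e eqxx in ab.
have per i m k : (a <= m)%N -> phi i ^+ (m + k * (b - a)) = phi i ^+ m.
  move=> am; elim: k => [|k IH]; first by rewrite mul0n addn0.
  have -> : (m + k.+1 * (b - a) = b + (m - a + k * (b - a)))%N by lia.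
  have eb : phi i ^+ b = phi i ^+ a by rewrite -!pwE eab.
  rewrite expmxD eb -expmxD -IH; congr (_ ^+ _); lia.
(* a multiple of the period [b - a] that is at least [a] *)
exists ((b - a) * a.+1)%N; first by rewrite muln_gt0 subn_gt0 lt_ab.
move=> i; rewrite -expmxD {2}mulnC per // mulnS; nia.
Qed.

(** Some power of the endomorphism is idempotent, hence 0 or 1. *)
Lemma endo_nilpotent_or_unit (Q : quiver) (F : finFieldType) (v : dimvec Q)
    (M : rep F v) (phi : forall i, 'M[F]_(v i)) :
  no_nontrivial_idempotent M -> commutes phi M ->
  exists2 N, (0 < N)%N &
    (forall i, phi i ^+ N = 0) \/ (forall i, phi i ^+ N = 1%:M).
Proof.
move=> noid comm; have [N N0 idN] := ex_idempotent_power phi.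
exists N => //; apply: noid => // a; exact: expmx_comm.
Qed.

Lemma dvdn_biggcd (I : finType) (m : I -> nat) (f : nat) :
  (forall i, f %| m i)%N -> (f %| \big[gcdn/0]_i m i)%N.
Proof. by move=> H; elim/big_ind: _ => // x y fx fy; rewrite dvdn_gcd fx. Qed.

(** Let [p] be a nonzero polynomial of least degree with [p(phi)] nilpotent.  Every
    polynomial in [phi] is nilpotent or a unit, so a factor of [p] is nilpotent
    at [phi] too, or else its cofactor is, and [p] is irreducible by minimality.
    Its degree divides every [v i], so it is 1 as [v] is indivisible. *)
Lemma endo_scalar_plus_nilpotent (Q : quiver) (F : finFieldType) (v : dimvec Q)
    (M : rep F v) (phi : forall i, 'M[F]_(v i)) :
  indivisible v -> no_nontrivial_idempotent M -> commutes phi M ->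
  exists c : F, forall i, nilpotent_mx (phi i - c%:M).
Proof.
move=> /andP[v0 /eqP gcd1] noid comm.
have [i0 vi0] := dimvec_neq0 v0.
have one0 : (1%:M : 'M[F]_(v i0)) <> 0.
  by move=> /(congr1 mxrank); rewrite mxrank1 mxrank0 => e; rewrite e in vi0.
pose nilp (p : {poly F}) := exists N, forall i, mxhorner (phi i) p ^+ N = 0.
have [p [pn0 [N pN] pmin]] : exists p : {poly F},
    [/\ p != 0, nilp p & forall q : {poly F}, q != 0 -> nilp q -> (size p <= size q)%N].
  pose P n := `[< exists p : {poly F}, [/\ p != 0, nilp p & size p = n] >].
  have exP : exists n, P n.
    (* annihilates every [phi i] by the theorem of Cayley and Hamilton *)
    pose p := \prod_i char_poly (phi i).
    exists (size p); apply/asboolP; exists p; split=> //.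
      by apply/prodf_neq0 => i _; rewrite monic_neq0 // char_poly_monic.
    exists 1%N => i; rewrite expr1 (dvdp_mxhorner0 _ (mxhorner_char _)) //.
    by rewrite /p (bigD1 i) //= dvdp_mulr.
  case: (ex_minnP exP) => n /asboolP[p [p0 pn ps]] nmin.
  exists p; split=> // q q0 qn; rewrite ps; apply: nmin; apply/asboolP.
  by exists q.
have ne q : nilp q \/ exists2 N, (0 < N)%N & forall i, mxhorner (phi i) q ^+ N = 1%:M.
  have cq : commutes (fun i => mxhorner (phi i) q) M.
    by move=> a; apply: mxhorner_comm.
  by have [N' N'0 [H|H]] := endo_nilpotent_or_unit noid cq; [left | right]; exists N'.
have nunit q N1 N2 : (0 < N2)%N -> (forall i, mxhorner (phi i) q ^+ N1 = 0) ->
    (forall i, mxhorner (phi i) q ^+ N2 = 1%:M) -> False.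
  move=> N20 /(_ i0) e1 /(_ i0) e2; apply: one0.
  have <- : mxhorner (phi i0) q ^+ (N2 * N1) = 1%:M by rewrite exprM e2 expr1n.
  by rewrite mulnC exprM e1 expr0n eqn0Ngt N20.
have p1 : (1 < size p)%N.
  rewrite ltnNge; apply/negP=> /size1_polyC pc.
  have c0 : p`_0 != 0 by apply: contraNneq pn0 => e; rewrite pc e.
  have pu : (p`_0 ^- N)%:P * p ^+ N = 1.
    by rewrite [in p ^+ N]pc -rmorphXn -rmorphM /= mulVf ?expf_neq0.
  apply: one0; rewrite -(mxhornerC (phi i0)) polyC1 -pu mxhornerM mxhornerXn pN.
  by rewrite mulmx0.
have irr : irreducible_poly p.
  split=> // q q1 qp; have [h ph] : exists h : {poly F}, p = h * q by apply/dvdpP.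
  have [h0 q0] : h != 0 /\ q != 0 by apply/andP; rewrite -negb_or -mulf_eq0 -ph.
  have sp : size p = (size h + size q).-1 by rewrite ph size_mul.
  case: (ne q) => [/(pmin _ q0) pq|[N1 N10 q1N]].
    by rewrite -(dvdp_size_eqp qp) eqn_leq pq andbT dvdp_leq.
  case: (ne h) => [/(pmin _ h0) pq|[N2 N20 h1N]].
    case/negP: q1; have hp : (0 < size h)%N by rewrite size_poly_gt0.
    have qp0 : (0 < size q)%N by rewrite size_poly_gt0.
    by rewrite eqn_leq qp0 andbT; rewrite sp in pq; lia.
  case: (nunit p N (N1 * N2)%N _ pN) => [|i]; first by rewrite muln_gt0 N10.
  rewrite -mxhornerXn ph exprMn mxhornerM [(N1 * N2)%N]mulnC exprM [(N2 * N1)%N]mulnC exprM.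
  by rewrite !mxhornerXn q1N h1N !expr1n mulmx1.
have p2 : size p = 2%N.
  have : ((size p).-1 %| \big[gcdn/0]_i v i)%N.
    by apply: dvdn_biggcd => i; apply: irreducible_annihilator_dvd irr (pN i).
  rewrite gcd1 dvdn1 => /eqP; lia.
have p10 : p`_1 != 0 by have := lead_coef_eq0 p; rewrite lead_coefE p2 /= => ->.
(* the root of the linear polynomial [p] *)
pose c := - ((p`_1)^-1 * p`_0).
have pE : 'X - c%:P = ((p`_1)^-1)%:P * p.
  apply/polyP=> k; rewrite coefCM coefB coefX coefC.
  case: k => [|[|k]] /=; first by rewrite sub0r opprK.
    by rewrite subr0 mulVf.
  by rewrite subr0 [p`_k.+2]nth_default ?mulr0 // p2.
exists c => i; exists N.
have -> : phi i - c%:M = mxhorner (phi i) ('X - c%:P).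
  by rewrite mxhornerD -polyCN mxhornerX mxhornerC [RHS]addrC -raddfN addrC.
by rewrite -mxhornerXn pE exprMn mxhornerM [X in _ *m X]mxhornerXn pN mulmx0.
Qed.

(** * Endomorphisms and extension of scalars *)

(** Take an expansion with the least number of terms: a linear relation between
    the [y k] would eliminate one of them. *)
Lemma independent_expansion (K L : fieldType) (f : {rmorphism K -> L}) (J : finType)
    (u : J -> L) :
  exists m (y : 'I_m -> L) (c : 'I_m -> J -> K),
    (forall j, u j = \sum_k y k * f (c k j)) /\
    (forall b : 'I_m -> K, \sum_k y k * f (b k) = 0 -> forall k, b k = 0).
Proof.
pose P m := `[< exists (y : 'I_m -> L) (c : 'I_m -> J -> K),
    forall j, u j = \sum_k y k * f (c k j) >].
have exP : exists m, P m.
  exists #|J|; apply/asboolP.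
  exists (fun k => u (enum_val k)), (fun k j => (enum_val k == j)%:R) => j.
  rewrite (bigD1 (enum_rank j)) //= enum_rankK eqxx rmorph1 mulr1 big1 ?addr0 // => k kj.
  rewrite (_ : _ == j = false) ?rmorph0 ?mulr0 //.
  by apply: contraNF kj => /eqP <-; rewrite enum_valK.
case: (ex_minnP exP) => m /asboolP[y [c yc]] mmin; exists m, y, c; split=> // b b0 k.
apply/eqP/negPn/negP=> bk.
case: m y c yc mmin b b0 k bk => [|m] y c yc mmin b b0 k bk; first by case: k bk.
have yk : y k = - \sum_(i < m) y (lift k i) * f (b (lift k i) / b k).
  have fb : f (b k) != 0 by rewrite fmorph_eq0.
  apply: (mulIf fb); move: b0; rewrite (bigD1_ord k) //= => /eqP.
  rewrite addr_eq0 => /eqP ->; rewrite mulNr mulr_suml; congr (- _).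
  by apply: eq_bigr => i _; rewrite fmorph_div -!mulrA mulVf ?mulr1.
(* Eliminating [y k] leaves [m] terms. *)
suff : P m by move/mmin; rewrite ltnn.
apply/asboolP; exists (fun i => y (lift k i)).
exists (fun i j => c (lift k i) j - b (lift k i) / b k * c k j) => j.
rewrite yc (bigD1_ord k) //= yk mulNr mulr_suml -sumrN -big_split /=.
by apply: eq_bigr => i _; rewrite rmorphB rmorphM /=; ring.
Qed.

(** Commuting with a representation over [K] is a linear condition with
    coefficients in [K], so it passes to the components of [phi] along
    coefficients that are independent over [K]. *)
Lemma scalar_endo_descent (Q : quiver) (K L : fieldType) (f : {rmorphism K -> L})
    (v : dimvec Q) (M : rep K v) (phi : forall i, 'M[L]_(v i)) :
  (forall psi : forall i, 'M[K]_(v i), commutes psi M ->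
     exists c : K, forall i, psi i = c%:M) ->
  commutes phi (fun a => map_mx f (M a)) ->
  exists c : L, forall i, phi i = c%:M.
Proof.
move=> sc comm.
have [m [y [c [yc ind]]]] := independent_expansion f
  (fun j : {i : vertex Q & ('I_(v i) * 'I_(v i))%type} =>
     phi (tag j) (tagged j).1 (tagged j).2).
pose psi k i : 'M[K]_(v i) := \matrix_(x, z) c k (existT _ i (x, z)).
have phiE i : phi i = \sum_k y k *: map_mx f (psi k i).
  apply/matrixP=> x z; rewrite summxE (yc (existT _ i (x, z))).
  by apply: eq_bigr => k _; rewrite !mxE.
have psic k : commutes (psi k) M.
  move=> a; apply/eqP; rewrite -subr_eq0; apply/eqP/matrixP=> x z.
  rewrite [RHS]mxE; apply: (ind (fun k => (psi k (src a) *m M a - M a *m psi k (tgt a)) x z)).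
  have := comm a; rewrite /= !phiE mulmx_suml mulmx_sumr => /eqP; rewrite -subr_eq0 -sumrB.
  move=> /eqP/matrixP/(_ x z); rewrite [RHS]mxE summxE => e; rewrite -[RHS]e; apply: eq_bigr => k' _.
  by rewrite -scalemxAl -scalemxAr -scalerBr -!map_mxM -map_mxB !mxE.
have [d dE] := fin_all_exists (fun k => sc _ (psic k)).
exists (\sum_k y k * f (d k)) => i; rewrite phiE.
rewrite [RHS]raddf_sum; apply: eq_bigr => k _.
by rewrite dE map_scalar_mx scale_scalar_mx.
Qed.

Lemma projection_commutes (Q : quiver) (K : fieldType) (v : dimvec Q) (M : rep K v)
    (U W : forall i, 'M[K]_(v i)) :
  subrep M U -> subrep M W -> (forall i, (U i :&: W i)%MS = 0) ->
  (forall i, (U i + W i :=: 1%:M)%MS) ->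
  commutes (fun i => proj_mx (U i) (W i)) M.
Proof.
move=> sU sW UW0 UW1 a; set s := src a; set t := tgt a.
have e : proj_mx (U s) (W s) + proj_mx (W s) (U s) = 1%:M.
  by have := @add_proj_mx _ _ _ (U s) (W s) 1%:M (UW0 s); rewrite !mul1mx UW1; apply.
rewrite -[M a in RHS]mul1mx -e !mulmxDl.
rewrite proj_mx_id // ?proj_mx_0 ?addr0 //.
  apply: submx_trans (sW a); apply: submxMr.
  by rewrite -[proj_mx _ _]mul1mx proj_mx_sub.
by apply: submx_trans (sU a); apply: submxMr; rewrite -[proj_mx _ _]mul1mx proj_mx_sub.
Qed.

(** The projection to one summand is an endomorphism, and it is scalar only if one
    of the summands is zero. *)
Lemma decomposable_nonscalar_endo (Q : quiver) (K : fieldType) (v : dimvec Q)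
    (M : rep K v) : v != 0 -> ~ indecomposable M ->
  exists2 phi : forall i, 'M[K]_(v i), commutes phi M & ~ exists c, forall i, phi i = c%:M.
Proof.
move=> v0 dec; apply: contrapT => sc; apply: dec; split=> // U W sU sW UW0 UW1.
have [c ce] : exists c, forall i, proj_mx (U i) (W i) = c%:M.
  apply: contrapT => no; apply: sc; exists (fun i => proj_mx (U i) (W i)) => //.
  exact: projection_commutes.
have [c1|c1] := eqVneq c 1; [right | left] => i.
  by have := proj_mx_0 (UW0 i) (submx_refl (W i)); rewrite ce c1 mulmx1.
have := proj_mx_id (UW0 i) (submx_refl (U i)); rewrite ce mul_mx_scalar => /eqP.
rewrite -subr_eq0 -{2}(scale1r (U i)) -scalerBl scaler_eq0 subr_eq0 (negPf c1) /=.
by move/eqP.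
Qed.

(** An idempotent endomorphism over [K] splits the representation after any
    extension of scalars. *)
Lemma indecomposable_no_idempotent (Q : quiver) (K L : fieldType)
    (f : {rmorphism K -> L}) (v : dimvec Q) (M : rep K v) :
  @indecomposable Q L v (fun a => map_mx f (M a)) -> no_nontrivial_idempotent M.
Proof.
move=> [_ ind] e comm idem.
pose U i := map_mx f (e i); pose W i := map_mx f (1%:M - e i).
have commW : commutes (fun i => 1%:M - e i) M.
  by move=> a; rewrite mulmxBl mulmxBr mul1mx mulmx1 comm.
have sub (g : forall i, 'M[K]_(v i)) : commutes g M ->
    subrep (fun a => map_mx f (M a)) (fun i => map_mx f (g i)).
  by move=> cg a; rewrite -map_mxM cg map_mxM submxMl.
have UW1 i : (U i + W i :=: 1%:M)%MS.
  apply/eqmxP; rewrite submx1 /=; have -> : 1%:M = U i + W i.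
    by rewrite /U /W -map_mxD addrC subrK map_mx1.
  exact: addmx_sub_adds.
have UW0 i : (U i :&: W i)%MS = 0.
  apply/eqP/rowV0P => x; rewrite sub_capmx => /andP[/submxP[a xa] /submxP[b xb]].
  have xe : x *m map_mx f (e i) = x.
    by rewrite xa -mulmxA -map_mxM idem.
  by rewrite -xe xb -mulmxA -map_mxM mulmxBl mul1mx idem subrr map_mx0 mulmx0.
have [H|H] := ind U W (sub _ comm) (sub _ commW) UW0 UW1; [left | right] => i.
  by apply: (map_mx_inj (f := f)); rewrite map_mx0 -/(U i) H.
apply/eqP; rewrite eq_sym -subr_eq0; apply/eqP.
by apply: (map_mx_inj (f := f)); rewrite map_mx0 -/(W i) H.
Qed.

(** * Isomorphism classes and automorphisms *)

Lemma rep_iso_refl (Q : quiver) (K : fieldType) (v : dimvec Q) (M : rep K v) : rep_iso M M.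
Proof.
by exists (fun i => 1%:M); split=> [i|a]; rewrite ?unitmx1 // mul1mx mulmx1.
Qed.

Lemma rep_iso_sym (Q : quiver) (K : fieldType) (v : dimvec Q) (M N : rep K v) :
  rep_iso M N -> rep_iso N M.
Proof.
move=> [g [gu gc]]; exists (fun i => invmx (g i)); split=> [i|a].
  by rewrite unitmx_inv.
by apply: (canRL (mulKmx (gu _))); rewrite mulmxA -gc mulmxK.
Qed.

Lemma rep_iso_trans (Q : quiver) (K : fieldType) (v : dimvec Q) (M N P : rep K v) :
  rep_iso M N -> rep_iso N P -> rep_iso M P.
Proof.
move=> [g [gu gc]] [h [hu hc]]; exists (fun i => g i *m h i); split=> [i|a].
  by rewrite unitmx_mul gu hu.
by rewrite mulmxA gc -mulmxA hc mulmxA.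
Qed.

Lemma indecomposable_iso (Q : quiver) (K : fieldType) (v : dimvec Q) (M N : rep K v) :
  rep_iso M N -> indecomposable M -> indecomposable N.
Proof.
move=> [g [gu gc]] [v0 ind]; split=> // U W sU sW UW0 UW1.
pose T (V : forall i, 'M[K]_(v i)) i := V i *m invmx (g i).
have subT V : subrep N V -> subrep M (T V).
  move=> sV a; rewrite /T.
  have -> : V (src a) *m invmx (g (src a)) *m M a =
            V (src a) *m N a *m invmx (g (tgt a)).
    apply: (canRL (mulmxK (gu _))).
    by rewrite -!mulmxA gc mulKmx.
  exact: submxMr.
have T0 V i : T V i = 0 -> V i = 0.
  by move=> e; rewrite -[V i](mulmxKV (gu i)) -/(T V i) e mul0mx.
have [] := ind (T U) (T W) (subT _ sU) (subT _ sW).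
- move=> i; apply/eqP/rowV0P => x; rewrite sub_capmx => /andP[xU xW].
  have : (x *m g i <= U i :&: W i)%MS.
    rewrite sub_capmx -[U i](mulmxKV (gu i)) -[W i](mulmxKV (gu i)).
    by rewrite !submxMr.
  rewrite UW0 submx0 => /eqP xg.
  by rewrite -[x](mulmxK (gu i)) xg mul0mx.
- move=> i; apply/eqmxP; rewrite submx1 /=.
  apply: (@submx_trans _ _ _ _ _ _ (invmx (g i))).
    by rewrite -(mulmxV (gu i)) submxMl.
  rewrite -(addsmxMr (U i) (W i)) -[X in (X <= _)%MS]mul1mx; apply: submxMr.
  by rewrite UW1.
- by move=> H; left=> i; apply: T0.
- by move=> H; right=> i; apply: T0.
Qed.

Lemma abs_indecomposable_iso (Q : quiver) (F : finFieldType) (v : dimvec Q) (M N : rep F v) :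
  rep_iso M N -> abs_indecomposable M -> abs_indecomposable N.
Proof.
move=> [g [gu gc]]; apply: indecomposable_iso.
exists (fun i => map_mx (alg_closure_in F) (g i)); split=> [i|a].
  by rewrite map_unitmx.
by rewrite -!map_mxM gc.
Qed.

Definition abs_indecomposables (Q : quiver) (F : finFieldType) (v : dimvec Q) :
    {set amaps F v v} := [set M : amaps F v v | `[< abs_indecomposable M >]].

Definition stab (Q : quiver) (F : finFieldType) (v : dimvec Q) (M : amaps F v v) :
    {set vmaps F v v} := [set g in gl F v | `[< commutes g M >]].

(** In each isomorphism class the stabilizers have total size [#|gl F v|]: the
    isomorphisms from a fixed member to the members [N] of the class partition
    the group, and those to [N] form a torsor under the stabilizer of [N]. *)
Lemma sum_card_stab (Q : quiver) (F : finFieldType) (v : dimvec Q) :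
  (\sum_(M in abs_indecomposables F v) #|stab M|)%N =
  (num_abs_indecomposable F v * #|gl F v|)%N.
Proof.
set X := abs_indecomposables F v.
pose E (M N : amaps F v v) := `[< @rep_iso Q F v M N >].
have -> : num_abs_indecomposable F v = #|equivalence_partition E X| by [].
have eqE : {in X & &, equivalence_rel E}.
  move=> M N P _ _ _; split; first by apply/asboolP; apply: rep_iso_refl.
  move=> /asboolP MN; apply/asboolP/asboolP; last exact: rep_iso_trans.
  by apply: rep_iso_trans; apply: rep_iso_sym.
rewrite (set_partition_big _ (equivalence_partitionP eqE)) /=.
rewrite -sum_nat_const; apply: eq_bigr => B /imsetP[M0 M0X ->].
pose act (g : vmaps F v v) : amaps F v v :=
  [ffun a => invmx (g (src a)) *m M0 a *m g (tgt a)].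
rewrite -[RHS]sum1_card.
have actE (g : vmaps F v v) (N : amaps F v v) : g \in gl F v ->
    (act g == N) = [forall a, M0 a *m g (tgt a) == g (src a) *m N a].
  rewrite inE => /forallP gu; apply/eqP/forallP => [<- a|H].
    by rewrite ffunE !mulmxA mulmxV // mul1mx.
  by apply/ffunP=> a; rewrite ffunE -mulmxA (eqP (H a)) mulKmx.
rewrite (partition_big act [pred N | N \in [set N in X | E M0 N]]) /=; last first.
  move=> g gG; have /asboolP iso : E M0 (act g).
    apply/asboolP; exists g; split; first by move: gG; rewrite inE => /forallP.
    by move=> a; have := actE g (act g) gG; rewrite eqxx => /esym/forallP/(_ a)/eqP.
  rewrite inE; apply/andP; split; last exact/asboolP.
  by move: M0X; rewrite !inE => /asboolP H; apply/asboolP; apply: abs_indecomposable_iso H.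
apply: eq_bigr => N; rewrite inE => /andP[_ /asboolP[g0 [g0u g0c]]].
rewrite sum1_card.
(* The isomorphisms from [M0] to [N] are [g0] times the stabilizer of [N]. *)
pose h (g : vmaps F v v) : vmaps F v v := [ffun i => g0 i *m g i].
have hinj : injective h.
  move=> g g' /ffunP e; apply/ffunP=> i; have := e i; rewrite !ffunE.
  by move/(can_inj (mulKmx (g0u i))).
rewrite -(card_imset (stab N) hinj); apply: eq_card => k; apply/imsetP/idP.
  move=> [g]; rewrite !inE => /andP[/forallP gu /asboolP gc] ->.
  have hG : h g \in gl F v.
    by rewrite inE; apply/forallP=> i; rewrite ffunE unitmx_mul g0u gu.
  rewrite -topredE /= hG actE //; apply/forallP=> a.
  by rewrite !ffunE mulmxA g0c -!mulmxA gc.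
rewrite -topredE /= => /andP[kG]; rewrite actE // => /forallP kc.
exists [ffun i => invmx (g0 i) *m k i]; last first.
  by apply/ffunP=> i; rewrite !ffunE mulmxA mulmxV // mul1mx.
move: kG; rewrite !inE => /forallP ku; apply/andP; split.
  by apply/forallP=> i; rewrite ffunE unitmx_mul unitmx_inv g0u ku.
apply/asboolP=> a; rewrite !ffunE -mulmxA -(eqP (kc a)) mulmxA.
rewrite [RHS]mulmxA; congr (_ *m _).
by apply: (canRL (mulmxK (g0u _))); rewrite -mulmxA g0c mulKmx.
Qed.

(** * The number of absolutely indecomposable representations *)

Lemma nilpotent_of_nonscalar (Q : quiver) (F : finFieldType) (v : dimvec Q)
    (M : amaps F v v) (phi : forall i, 'M[F]_(v i)) (c : F) :
  commutes phi M -> (forall i, nilpotent_mx (phi i - c%:M)) ->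
  ~ (forall i, phi i = c%:M) ->
  ([ffun i => phi i - c%:M] : vmaps F v v, M) \in nonzero_nilpotent_pairs F v.
Proof.
move=> comm nil nsc; rewrite !inE; apply/andP; split.
  apply/asboolP; split=> [a|i] /=; last by rewrite ffunE.
  by rewrite !ffunE mulmxBl mulmxBr comm scalar_mxC.
apply: contrapT => /negP; rewrite negb_exists => /forallP H; apply: nsc => i.
by apply/eqP; rewrite -subr_eq0; have := H i; rewrite negbK ffunE.
Qed.

(** Such a representation has a nonscalar endomorphism.  If it has no nontrivial
    idempotent, subtracting a scalar leaves a nonzero nilpotent. *)
Lemma not_abs_indecomposable_sub (Q : quiver) (F : finFieldType) (v : dimvec Q) :
  indivisible v ->
  ~: abs_indecomposables F v \subset
    [set p.2 | p in nontrivial_idempotent_pairs F v :|: nonzero_nilpotent_pairs F v].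
Proof.
move=> vi; have v0 : v != 0 by case/andP: vi.
apply/subsetP=> M; rewrite !inE => /asboolP nM; apply/imsetP.
have [phi comm nsc] : exists2 phi : forall i, 'M[F]_(v i),
    commutes phi M & ~ exists c, forall i, phi i = c%:M.
  apply: contrapT => no; have [phi comm] := decomposable_nonscalar_endo v0 nM; apply.
  apply: (scalar_endo_descent (f := alg_closure_in F) (M := M)) => // psi cpsi.
  by apply: contrapT => nsc; apply: no; exists psi.
have [noid|] := pselect (no_nontrivial_idempotent M).
  have [c nil] := endo_scalar_plus_nilpotent vi noid comm.
  exists ([ffun i => phi i - c%:M], M) => //; rewrite in_setU.
  by rewrite nilpotent_of_nonscalar ?orbT // => e; apply: nsc; exists c.
move=> /existsNP[e /not_implyP[ce /not_implyP[idem /not_orP[e0 e1]]]].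
exists ([ffun i => e i] : vmaps F v v, M) => //; rewrite !inE; apply/orP; left.
apply/andP; split; first by apply/asboolP; split=> [a|i] /=; rewrite !ffunE.
apply/andP; split; apply: contrapT => /negP; rewrite negb_exists => /forallP H.
  by apply: e0 => i; have := H i; rewrite negbK ffunE => /eqP.
by apply: e1 => i; have := H i; rewrite negbK ffunE => /eqP.
Qed.

Lemma scalar_inj (Q : quiver) (F : finFieldType) (v : dimvec Q) : v != 0 ->
  injective (fun c : F => [ffun i => c%:M] : vmaps F v v).
Proof.
move=> v0 c c' /ffunP e.
have [i vi] := dimvec_neq0 v0.
have := e i; rewrite !ffunE => /matrixP/(_ (Ordinal vi) (Ordinal vi)).
by rewrite !mxE eqxx.
Qed.

Definition scalars (Q : quiver) (F : finFieldType) (v : dimvec Q) : {set vmaps F v v} :=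
  [set ([ffun i => c%:M] : vmaps F v v) | c in [set~ (0 : F)]].

Lemma card_scalars (Q : quiver) (F : finFieldType) (v : dimvec Q) : v != 0 ->
  #|scalars F v| = (#|F| - 1)%N.
Proof.
move=> v0; rewrite card_imset; last exact: scalar_inj.
by rewrite cardsC1 subn1.
Qed.

Lemma scalars_sub_stab (Q : quiver) (F : finFieldType) (v : dimvec Q) (M : amaps F v v) :
  scalars F v \subset stab M.
Proof.
apply/subsetP=> g /imsetP[c]; rewrite !inE => c0 ->; apply/andP; split.
  by apply/forallP=> i; rewrite ffunE unitmxE det_scalar unitfE expf_neq0.
by apply/asboolP=> a; rewrite !ffunE scalar_mxC.
Qed.

Definition nilpotent_fibre (Q : quiver) (F : finFieldType) (v : dimvec Q)
    (M : amaps F v v) : {set vmaps F v v} :=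
  [set phi | (phi, M) \in nonzero_nilpotent_pairs F v].

(** Every automorphism is a scalar plus a nilpotent endomorphism.  The nilpotent
    part is zero for [q - 1] of them, and otherwise there are at most [q] scalars
    for each nilpotent. *)
Lemma card_stab_le (Q : quiver) (F : finFieldType) (v : dimvec Q) (M : amaps F v v) :
  indivisible v -> M \in abs_indecomposables F v ->
  (#|stab M| <= (#|F| - 1) + #|F| * #|nilpotent_fibre M|)%N.
Proof.
move=> vi; rewrite inE => /asboolP ind; have v0 : v != 0 by case/andP: vi.
have noid := indecomposable_no_idempotent ind.
pose T := [set ([ffun i => x.1%:M + x.2 i] : vmaps F v v)
           | x : (F * vmaps F v v)%type in setX [set: F] (nilpotent_fibre M)].
apply: (@leq_trans #|scalars F v :|: T|).
  apply/subset_leq_card/subsetP=> g; rewrite inE => /andP[gG /asboolP comm].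
  have [c nil] := endo_scalar_plus_nilpotent vi noid comm.
  have [sc|nsc] := pselect (forall i, g i = c%:M); rewrite inE; apply/orP; [left|right].
    apply/imsetP; exists c; last by apply/ffunP=> i; rewrite ffunE sc.
    rewrite !inE; apply: contraNneq v0 => c0; apply/eqP/ffunP=> i; rewrite [RHS]ffunE.
    move: gG; rewrite inE => /forallP/(_ i); rewrite sc c0 => /mxrank_unit.
    by rewrite raddf0 mxrank0.
  apply/imsetP; exists (c, [ffun i => g i - c%:M]); last first.
    by apply/ffunP=> i; rewrite !ffunE /= addrC subrK.
  by rewrite in_setX inE /= inE nilpotent_of_nonscalar.
apply: leq_trans (leq_card_setU _ _) _.
rewrite card_scalars // leq_add2l; apply: leq_trans (leq_imset_card _ _) _.
by rewrite cardsX cardsT.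
Qed.

(** From below every stabilizer contains the nonzero scalars, and few
    representations fail to be absolutely indecomposable; from above the
    stabilizers contain little else. *)
Lemma num_abs_indecomposable_bounds (Q : quiver) (F : finFieldType) (v : dimvec Q) :
  indivisible v ->
  let q := #|F| in
  let I := #|nontrivial_idempotent_pairs F v| in
  let N := #|nonzero_nilpotent_pairs F v| in
  ((q - 1) * q ^ apair v v <= num_abs_indecomposable F v * gl_order v q + (q - 1) * (I + N))%N /\
  (num_abs_indecomposable F v * gl_order v q <= (q - 1) * q ^ apair v v + q * N)%N.
Proof.
move=> vi q I N; have v0 : v != 0 by case/andP: vi.
rewrite -card_gl -sum_card_stab.
have cR : #|{: amaps F v v}| = (q ^ apair v v)%N by exact: card_dffun_mx.
have cX := cardsC (abs_indecomposables F v); rewrite cR in cX.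
split.
  have cB : (#|~: abs_indecomposables F v| <= I + N)%N.
    apply: leq_trans (subset_leq_card (not_abs_indecomposable_sub F vi)) _.
    by apply: leq_trans (leq_imset_card _ _) _; apply: leq_card_setU.
  have : (#|abs_indecomposables F v| * (q - 1) <=
          \sum_(M in abs_indecomposables F v) #|stab M|)%N.
    rewrite -sum_nat_const; apply: leq_sum => M _.
    by rewrite -(card_scalars F v0) subset_leq_card // scalars_sub_stab.
  rewrite -cX; nia.
apply: (@leq_trans (\sum_(M in abs_indecomposables F v)
                     ((q - 1) + q * #|nilpotent_fibre M|))%N).
  by apply: leq_sum => M MX; apply: card_stab_le.
rewrite big_split /= sum_nat_const -big_distrr /= leq_add //.
  by rewrite -cX mulnC leq_mul2l leq_addr orbT.
rewrite leq_mul2l; apply/orP; right.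
rewrite /N -sum1_card (partition_big (fun p => p.2) xpredT) //=.
rewrite [leqRHS](bigID (mem (abs_indecomposables F v))) /=.
apply: leq_trans (leq_addr _ _).
apply: leq_sum => M _; rewrite sum1_card.
have inj : injective (fun phi : vmaps F v v => (phi, M)) by move=> x y [].
rewrite -(card_imset _ inj); apply/subset_leq_card/subsetP=> p /imsetP[phi].
by rewrite inE => H ->; rewrite -topredE /= H eqxx.
Qed.

(** * The Cartan form *)

Lemma euler_formDl (Q : quiver) (x y z : lattice Q) :
  euler_form (x + y) z = euler_form x z + euler_form y z.
Proof.
rewrite /euler_form addrACA -opprD -!big_split /=; congr (_ - _).
  by apply: eq_bigr => i _; rewrite ffunE mulrDl.
by apply: eq_bigr => a _; rewrite ffunE mulrDl.
Qed.

Lemma euler_formDr (Q : quiver) (x y z : lattice Q) :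
  euler_form z (x + y) = euler_form z x + euler_form z y.
Proof.
rewrite /euler_form addrACA -opprD -!big_split /=; congr (_ - _).
  by apply: eq_bigr => i _; rewrite ffunE mulrDr.
by apply: eq_bigr => a _; rewrite ffunE mulrDr.
Qed.

Lemma cartan_formDl (Q : quiver) (x y z : lattice Q) :
  cartan_form (x + y) z = cartan_form x z + cartan_form y z.
Proof. by rewrite /cartan_form euler_formDl euler_formDr addrACA. Qed.

Lemma cartan_formC (Q : quiver) (x y : lattice Q) : cartan_form x y = cartan_form y x.
Proof. exact: addrC. Qed.

Lemma cartan_formDr (Q : quiver) (x y z : lattice Q) :
  cartan_form z (x + y) = cartan_form z x + cartan_form z y.
Proof. by rewrite !(cartan_formC z) cartan_formDl. Qed.

Lemma cartan_entryC (Q : quiver) (i j : vertex Q) : cartan_entry i j = cartan_entry j i.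
Proof. exact: cartan_formC. Qed.

Lemma cartan_entry_le0 (Q : quiver) (i j : vertex Q) : i != j -> cartan_entry i j <= 0.
Proof.
move=> ij; have eu (k l : vertex Q) : k != l ->
    euler_form (simple_root k) (simple_root l) <= 0.
  move=> kl; rewrite /euler_form big1 ?sub0r ?oppr_le0 ?sumr_ge0 // => [a _|n _].
    by rewrite !ffunE mulr_ge0.
  by rewrite !ffunE; case: eqVneq => [<-|]; rewrite ?mul0r // eq_sym (negPf kl) mulr0.
by rewrite -(addr0 0) lerD ?eu // eq_sym.
Qed.

Lemma sum_delta (I : finType) (R : nzRingType) (x : I -> R) (k : I) :
  \sum_i x i * (i == k)%:R = x k.
Proof.
rewrite (bigD1 k) //= eqxx mulr1 big1 ?addr0 // => i /negPf->; exact: mulr0.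
Qed.

Lemma euler_form_expand (Q : quiver) (x y : lattice Q) :
  euler_form x y =
  \sum_i \sum_j x i * y j * euler_form (simple_root i) (simple_root j).
Proof.
have D (k l : vertex Q) : x k * y l =
    \sum_i \sum_j x i * y j * (simple_root i k * simple_root j l).
  rewrite -{1}(sum_delta x k) mulr_suml; apply: eq_bigr => i _.
  rewrite -(sum_delta y l) mulr_sumr; apply: eq_bigr => j _.
  by rewrite !ffunE !natz; ring.
rewrite {1}/euler_form (eq_bigr _ (fun i _ => D i i)).
rewrite [X in _ - X](eq_bigr _ (fun a _ => D (src a) (tgt a))).
rewrite exchange_big [X in _ - X]exchange_big -sumrB; apply: eq_bigr => i _.
rewrite exchange_big [X in _ - X]exchange_big -sumrB; apply: eq_bigr => j _.
by rewrite -!mulr_sumr -mulrBr.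
Qed.

Lemma cartan_form_expand (Q : quiver) (x y : lattice Q) :
  cartan_form x y = \sum_i \sum_j cartan_entry i j * (x i * y j).
Proof.
rewrite /cartan_form (euler_form_expand x y) (euler_form_expand y x).
rewrite [X in _ + X]exchange_big -big_split; apply: eq_bigr => i _.
rewrite -big_split; apply: eq_bigr => j _ /=.
by rewrite /cartan_entry /cartan_form; ring.
Qed.

Lemma cartan_form_simple (Q : quiver) (i : vertex Q) (y : lattice Q) :
  cartan_form (simple_root i) y = \sum_j cartan_entry i j * y j.
Proof.
rewrite cartan_form_expand (bigD1 i) //= [X in _ + X]big1 ?addr0 => [|k ki].
  by apply: eq_bigr => j _; rewrite ffunE eqxx mul1r.
by rewrite big1 // => j _; rewrite ffunE eq_sym (negPf ki) mul0r mulr0.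
Qed.

Lemma to_latticeD (Q : quiver) (v w : dimvec Q) :
  to_lattice (v + w) = to_lattice v + to_lattice w.
Proof. by apply/ffunP=> i; rewrite !ffunE PoszD. Qed.

Definition dcartan (Q : quiver) (v w : dimvec Q) : int :=
  cartan_form (to_lattice v) (to_lattice w).

Lemma dcartan_self (Q : quiver) (v : dimvec Q) :
  dcartan v v = ((vpair v v)%:Z - (apair v v)%:Z) *+ 2.
Proof.
rewrite /dcartan /cartan_form mulr2n.
have -> // : euler_form (to_lattice v) (to_lattice v) = (vpair v v)%:Z - (apair v v)%:Z.
rewrite /euler_form /vpair /apair !(big_morph Posz PoszD (erefl _)); congr (_ - _); apply: eq_bigr => i _;
  by rewrite !ffunE PoszM.
Qed.

(** * The inequality of Kac *)

(** With [vi = wi + ui] and [vj = wj + uj], the difference of the two sides is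
    [(wi vj - wj vi)^2 / (vi vj)]. *)
Lemma kac_term_ge (R : realFieldType) (wi ui wj uj : R) :
  0 <= wi -> 0 <= ui -> 0 <= wj -> 0 <= uj ->
  wi * ui / (wi + ui) * (wj + uj) + wj * uj / (wj + uj) * (wi + ui)
    <= wi * uj + wj * ui.
Proof.
move=> wi0 ui0 wj0 uj0.
have [ei|ei] := eqVneq (wi + ui) 0.
  by rewrite ei invr0 !mulr0 mul0r addr0 addr_ge0 ?mulr_ge0.
have [ej|ej] := eqVneq (wj + uj) 0.
  by rewrite ej invr0 !mulr0 mul0r addr0 addr_ge0 ?mulr_ge0.
have pi : 0 < wi + ui by rewrite lt_def ei addr_ge0.
have pj : 0 < wj + uj by rewrite lt_def ej addr_ge0.
rewrite -subr_ge0.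
have -> : wi * uj + wj * ui -
    (wi * ui / (wi + ui) * (wj + uj) + wj * uj / (wj + uj) * (wi + ui)) =
    (wi * (wj + uj) - wj * (wi + ui)) ^+ 2 / ((wi + ui) * (wj + uj)).
  by field; rewrite ei ej.
by rewrite divr_ge0 ?sqr_ge0 // mulr_ge0 // ltW.
Qed.

Definition kac_weight (Q : quiver) (w u : dimvec Q) (i : vertex Q) : rat :=
  (w i)%:R * (u i)%:R / ((w i)%:R + (u i)%:R).

(** After symmetrization the terms with [i = j] agree on both sides, and the
    others compare by [kac_term_ge] because [cartan_entry i j <= 0]. *)
Lemma dcartan_le_weights (Q : quiver) (w u : dimvec Q) :
  (dcartan w u)%:~R <=
  \sum_i kac_weight w u i * (cartan_form (simple_root i) (to_lattice (w + u)))%:~R.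
Proof.
pose c i j : rat := (@cartan_entry Q i j)%:~R.
pose W i : rat := (w i)%:R; pose U i : rat := (u i)%:R.
have e1 : (dcartan w u)%:~R = \sum_i \sum_j c i j * (W i * U j).
  rewrite /dcartan cartan_form_expand rmorph_sum; apply: eq_bigr => i _.
  by rewrite rmorph_sum; apply: eq_bigr => j _; rewrite !ffunE !rmorphM.
have e2 : \sum_i kac_weight w u i * (cartan_form (simple_root i) (to_lattice (w + u)))%:~R =
    \sum_i \sum_j c i j * (kac_weight w u i * (W j + U j)).
  apply: eq_bigr => i _; rewrite cartan_form_simple rmorph_sum mulr_sumr.
  apply: eq_bigr => j _; rewrite to_latticeD !ffunE rmorphM /= (intrD _ (w j)%:Z (u j)%:Z) /c /W /U.
  by rewrite mulrCA.
have cC i j : c i j = c j i by rewrite /c cartan_entryC.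
have sym (f : vertex Q -> vertex Q -> rat) :
    2 * (\sum_i \sum_j c i j * f i j) = \sum_i \sum_j c i j * (f i j + f j i).
  rewrite mulrDl mul1r [X in _ + X]exchange_big -big_split; apply: eq_bigr => i _ /=.
  by rewrite -big_split; apply: eq_bigr => j _ /=; rewrite (cC j i) mulrDr.
rewrite -(ler_pM2l (_ : 0 < 2 :> rat)) // e1 e2 !sym.
apply: ler_sum => i _; apply: ler_sum => j _.
have [<-|ij] := eqVneq i j.
  rewrite le_eqVlt; apply/orP; left; apply/eqP; congr (_ * _).
  rewrite /kac_weight -/(W i) -/(U i).
  have [e0|e0] := eqVneq (W i + U i) 0; last by field.
  have [W0 U0] : W i = 0 /\ U i = 0.
    by move/eqP: e0; rewrite paddr_eq0 ?ler0n // => /andP[/eqP-> /eqP->].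
  by rewrite W0 U0; ring.
apply: ler_wnM2l; first by rewrite /c lerz0 cartan_entry_le0.
by rewrite /kac_weight -/(W i) -/(U i) -/(W j) -/(U j); apply: kac_term_ge; apply: ler0n.
Qed.

Lemma kac_weight_ge0 (Q : quiver) (w u : dimvec Q) i : 0 <= kac_weight w u i.
Proof. by rewrite /kac_weight divr_ge0 ?mulr_ge0 ?addr_ge0 ?ler0n. Qed.

Lemma kac_weight_ge_half (Q : quiver) (w u : dimvec Q) i :
  (0 < w i)%N -> (0 < u i)%N -> 1 <= 2 * kac_weight w u i.
Proof.
move=> w0 u0; rewrite /kac_weight mulrA ler_pdivlMr ?addr_gt0 ?ltr0n // mul1r.
have w1 : 1 <= (w i)%:R :> rat by rewrite ler1n.
have u1 : 1 <= (u i)%:R :> rat by rewrite ler1n.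
nra.
Qed.

Lemma dimvecMn (Q : quiver) (v : dimvec Q) n i : (v *+ n) i = (v i * n)%N.
Proof.
elim: n => [|n IH]; first by rewrite mulr0n muln0 ffunE.
by rewrite mulrS dimvecD IH mulnS.
Qed.

(** The subgraph on the support of [delta] cannot be cut into [S] and its
    complement with no edge between them, unless one side is empty. *)
Definition support_connected (Q : quiver) (delta : dimvec Q) : Prop :=
  forall S : {set vertex Q},
    (forall i j, i \in S -> j \notin S -> delta i != 0%N -> delta j != 0%N ->
       cartan_entry i j = 0) ->
    (forall i, delta i != 0%N -> i \in S) \/ (forall i, delta i != 0%N -> i \notin S).

Lemma dcartan_disjoint_le (Q : quiver) (w u : dimvec Q) (i j : vertex Q) :
  (forall k, w k * u k = 0)%N -> cartan_entry i j != 0 -> i != j ->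
  dcartan w u <= - (w i * u j)%:Z.
Proof.
move=> wu cij ij; rewrite /dcartan cartan_form_expand.
have neg k l : cartan_entry k l * (to_lattice w k * to_lattice u l) <= 0.
  rewrite !ffunE -PoszM; have [<-|kl] := eqVneq k l; first by rewrite wu mulr0.
  by rewrite mulr_le0_ge0 ?cartan_entry_le0.
rewrite (bigD1 i) //= (bigD1 j) //=.
have h1 : \sum_(l | l != j) cartan_entry i l * (to_lattice w i * to_lattice u l) <= 0.
  by apply: sumr_le0.
have h2 : \sum_(k | k != i) \sum_l cartan_entry k l * (to_lattice w k * to_lattice u l) <= 0.
  by apply: sumr_le0 => k _; apply: sumr_le0.
have h3 : cartan_entry i j * (to_lattice w i * to_lattice u j) <= - (w i * u j)%:Z.
  rewrite !ffunE -PoszM -mulN1r ler_wpM2r //.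
  by have := cartan_entry_le0 ij; move: cij; lia.
by rewrite -[leRHS]addr0 -[leRHS]addr0 lerD // lerD.
Qed.

(** All terms of the form have the same sign, so one edge between the two supports
    suffices.  If the support of [delta] meets both sides, connectedness provides
    an edge inside it; otherwise one side avoids it, and a vertex there has a
    neighbour in the support because the form of its simple root with [delta] is
    negative. *)
Lemma dcartan_split_disjoint_le (Q : quiver) (d delta w u : dimvec Q) (n : nat) :
  (0 < n)%N -> support_connected delta ->
  (forall i, cartan_form (simple_root i) (to_lattice delta) < 0) ->
  w + u = d + delta *+ n -> w != 0 -> u != 0 -> (forall k, w k * u k = 0)%N ->
  dcartan w u <= - n%:Z.
Proof.
move=> n0 con neg wun w0 u0 wu.
have vE i : (w i + u i = d i + delta i * n)%N.
  by rewrite -dimvecD wun dimvecD dimvecMn.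
have big i : delta i != 0%N -> (n <= w i + u i)%N.
  by rewrite vE; case: (delta i) => // m _; rewrite mulSn; lia.
have nbr j : delta j = 0%N -> exists i, [/\ i != j, delta i != 0%N & cartan_entry j i != 0].
  move=> dj; apply: contrapT => no; have := neg j; rewrite cartan_form_simple big1 ?ltxx //.
  move=> i _; rewrite ffunE; have [->|di] := eqVneq (delta i) 0%N; first by rewrite mulr0.
  have [->|cji] := eqVneq (cartan_entry j i) 0; first by rewrite mul0r.
  by case: no; exists i; split=> //; apply: contraNneq di => ->; rewrite dj.
have via i j : cartan_entry i j != 0 -> w i != 0%N -> u j != 0%N ->
    delta i != 0%N \/ delta j != 0%N -> dcartan w u <= - n%:Z.
  move=> cij wi uj dij.
  have ij : i != j by apply/eqP=> e; have := wu i; rewrite {2}e; nia.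
  apply: le_trans (dcartan_disjoint_le wu cij ij) _; rewrite lerN2 lez_nat.
  have [/big|/big] := dij.
    by have := wu i; nia.
  by have := wu j; nia.
have swap (x y : dimvec Q) : (forall k, x k * y k = 0)%N ->
    (forall i, delta i != 0%N -> x i != 0%N) -> y != 0 ->
    exists i j, [/\ cartan_entry i j != 0, x i != 0%N, y j != 0%N & delta i != 0%N].
  move=> xy xd /dimvec_neq0[j]; rewrite lt0n => yj.
  have dj : delta j = 0%N by apply: contra_eq (xy j) => /xd; nia.
  by have [i [ij di cji]] := nbr j dj; exists i, j; rewrite cartan_entryC cji xd.
(* Either an edge inside the support of [delta] joins the two sides, or [all_z]. *)
have [all_z|/existsNP[i /existsNP[j]]] := pselect (forall i j, w i != 0%N -> w j = 0%N ->
    delta i != 0%N -> delta j != 0%N -> cartan_entry i j = 0); last first.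
  move=> /not_implyP[wi /not_implyP[wj /not_implyP[di /not_implyP[dj cij]]]].
  apply: (via i j); [exact/eqP | exact: wi | | by left].
  have /eqP wj0 := wj; have := big j dj; rewrite wj; lia.
have closed i j : i \in [set i | w i != 0%N] -> j \notin [set i | w i != 0%N] ->
    delta i != 0%N -> delta j != 0%N -> cartan_entry i j = 0.
  by rewrite !inE negbK => wi /eqP wj; apply: all_z.
have [H|H] := con _ closed.
- have [|i [j [cij wi uj di]]] := swap w u wu _ u0.
    by move=> i /H; rewrite inE.
  by apply: (via i j) => //; left.
have [||i [j [cij ui wj di]]] := swap u w _ _ w0.
- by move=> k; rewrite mulnC.
- move=> i di; have := H i di; rewrite inE negbK => /eqP wi; have := big i di.
  by rewrite wi; lia.
by apply: (via j i) => //; [rewrite cartan_entryC | right].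
Qed.

(** If a vertex lies in the supports of both [w] and [u], its weight is at least
    1/2, so a bound by [- 2 m] on the form of its simple root with [w + u] yields
    [- m].  Otherwise the supports are disjoint. *)
Lemma kac_bound (Q : quiver) (d delta : dimvec Q) (m : nat) :
  support_connected delta ->
  (forall i, cartan_form (simple_root i) (to_lattice delta) < 0) ->
  exists N, forall n, (N <= n)%N ->
    (forall i, cartan_form (simple_root i) (to_lattice (d + delta *+ n)) <= - (2 * m)%:Z) /\
    forall w u : dimvec Q, w + u = d + delta *+ n -> w != 0 -> u != 0 ->
      dcartan w u <= - m%:Z.
Proof.
move=> con neg.
pose K := (\sum_i `|cartan_form (simple_root i) (to_lattice d)|)%N.
exists (K + 2 * m).+1 => n Nn.
have neg2 i : cartan_form (simple_root i) (to_lattice (d + delta *+ n)) <= - (2 * m)%:Z.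
  rewrite to_latticeD cartan_formDr.
  have -> : cartan_form (simple_root i) (to_lattice (delta *+ n)) =
            cartan_form (simple_root i) (to_lattice delta) * n%:Z.
    rewrite !cartan_form_simple mulr_suml; apply: eq_bigr => j _.
    by rewrite !ffunE dimvecMn PoszM mulrA.
  have KI : (`|cartan_form (simple_root i) (to_lattice d)| <= K)%N.
    by rewrite /K (bigD1 i) //= leq_addr.
  have := neg i; set x := cartan_form _ _ in KI *; set y := cartan_form _ (to_lattice delta).
  by move=> y0; nia.
split=> // w u wun w0 u0.
have [/existsP[i wui]|/existsPn H] := boolP [exists i, (w i * u i)%N != 0%N]; last first.
  have n0 : (0 < n)%N by lia.
  apply: le_trans (dcartan_split_disjoint_le n0 con neg wun w0 u0 _) _.
    by move=> k; have := H k; rewrite negbK => /eqP.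
  by lia.
rewrite -(@ler_int rat); apply: le_trans (dcartan_le_weights w u) _.
rewrite wun (bigD1 i) //=.
move: wui; rewrite muln_eq0 negb_or -!lt0n => /andP[wi ui].
have k1 := kac_weight_ge_half wi ui.
have n1 : (cartan_form (simple_root i) (to_lattice (d + delta *+ n)))%:~R <=
          - (2 * m%:R) :> rat.
  have : (cartan_form (simple_root i) (to_lattice (d + delta *+ n)))%:~R <=
         (- (2 * m)%:Z)%:~R :> rat by rewrite ler_int.
  by rewrite rmorphN /= -pmulrn natrM.
have rest : \sum_(k | k != i) kac_weight w u k *
    (cartan_form (simple_root k) (to_lattice (d + delta *+ n)))%:~R <= 0.
  apply: sumr_le0 => k _; apply: mulr_ge0_le0; first exact: kac_weight_ge0.
  by rewrite lerz0 (le_trans (neg2 k)) // oppr_le0.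
rewrite rmorphN /= -pmulrn -[leRHS]addr0 lerD //.
have m0 : 0 <= m%:R :> rat by apply: ler0n.
by nra.
Qed.

Lemma dcartan_Dl (Q : quiver) (u v w : dimvec Q) :
  dcartan (u + v) w = dcartan u w + dcartan v w.
Proof. by rewrite /dcartan to_latticeD cartan_formDl. Qed.

Lemma dcartan_Dr (Q : quiver) (u v w : dimvec Q) :
  dcartan w (u + v) = dcartan w u + dcartan w v.
Proof. by rewrite /dcartan to_latticeD cartan_formDr. Qed.

Lemma dcartan_suml (Q : quiver) (s : seq (dimvec Q)) (v : dimvec Q) :
  dcartan (\sum_(w <- s) w) v = \sum_(w <- s) dcartan w v.
Proof.
elim: s => [|w s IH]; last by rewrite !big_cons dcartan_Dl IH.
by rewrite !big_nil; have := dcartan_Dl 0 0 v; rewrite addr0; lia.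
Qed.

(** Twice the difference of the exponents of the trivial decomposition and of [s]
    is the sum over the parts [w] of the form of [w] with [v - w], and there are
    at least two parts. *)
Lemma decomposition_bound_of_kac (Q : quiver) (v : dimvec Q) (m : nat) :
  v != 0 ->
  (forall i, cartan_form (simple_root i) (to_lattice v) <= - (2 * m)%:Z) ->
  (forall w u : dimvec Q, w + u = v -> w != 0 -> u != 0 -> dcartan w u <= - m%:Z) ->
  (m <= apair v v)%N /\ decomposition_bound 2 v (apair v v - m).
Proof.
move=> v0 neg kac.
have mv : (m <= apair v v)%N.
  have [i vi] := dimvec_neq0 v0.
  have : dcartan v v <= - (2 * m)%:Z.
    rewrite /dcartan cartan_form_expand.
    have E k : \sum_j cartan_entry k j * (to_lattice v k * to_lattice v j) =
               (v k)%:Z * cartan_form (simple_root k) (to_lattice v).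
      rewrite cartan_form_simple mulr_sumr; apply: eq_bigr => j _.
      by rewrite !ffunE mulrCA.
    rewrite (eq_bigr _ (fun k _ => E k)) (bigD1 i) //= -[leRHS]addr0 lerD //.
      by have := neg i; move: vi; nia.
    by apply: sumr_le0 => k _; have := neg k; nia.
  by rewrite dcartan_self; lia.
split=> // s s2 s0 sv.
have le_part w : w \in s -> dcartan w v <= dcartan w w - m%:Z.
  move=> ws; have ev : v = w + \sum_(x <- rem w s) x.
    by rewrite -sv (perm_big _ (perm_to_rem ws)) big_cons.
  rewrite {1}ev dcartan_Dr lerD2l; apply: kac => //.
    by apply: contraNneq s0 => <-.
  have := size_rem ws; case: (rem w s) (@mem_rem _ w s) => [|x t] sub st.
    by move: st; rewrite -(subnKC s2).
  have x0 : x != 0.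
    by apply: contraNneq s0 => <-; apply: sub; rewrite mem_head.
  rewrite big_cons; apply: contraNneq x0 => /ffunP e; apply/eqP/ffunP=> i.
  by have /eqP := e i; rewrite dimvecD [X in _ == X]ffunE addn_eq0 => /andP[/eqP-> _]; rewrite ffunE.
have : \sum_(w <- s) dcartan w v <= \sum_(w <- s) (dcartan w w - m%:Z).
  by rewrite big_seq [leRHS]big_seq; apply: ler_sum.
rewrite -dcartan_suml sv sumrB dcartan_self.
have -> : \sum_(w <- s) m%:Z = (m * size s)%:Z.
  by rewrite big_const_seq count_predT iter_addr addr0 PoszM -mulr_natr natz.
rewrite (eq_bigr _ (fun w _ => dcartan_self w)) sumrMnl sumrB.
rewrite -!(big_morph Posz PoszD (erefl _)).
set X := (\sum_(w <- s) vpair w w)%N; set Y := (\sum_(w <- s) apair w w)%N.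
by have : (m * 2 <= m * size s)%N; [rewrite leq_mul2l s2 orbT | lia].
Qed.

(** * The Lie algebra of a quiver *)

#[local] Instance lie_eq_equiv (Q : quiver) : Equivalence (@lie_eq Q).
Proof.
split; [exact: lie_refl | exact: lie_sym | exact: lie_trans].
Qed.

#[local] Instance LieAdd_proper (Q : quiver) :
  Proper (@lie_eq Q ==> @lie_eq Q ==> @lie_eq Q) (@LieAdd Q).
Proof. by move=> x x' ex y y' ey; apply: lie_add_congr. Qed.

#[local] Instance LieScale_proper (Q : quiver) c :
  Proper (@lie_eq Q ==> @lie_eq Q) (@LieScale Q c).
Proof. by move=> x x' ex; apply: lie_scale_congr. Qed.

#[local] Instance LieBr_proper (Q : quiver) :
  Proper (@lie_eq Q ==> @lie_eq Q ==> @lie_eq Q) (@LieBr Q).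
Proof. by move=> x x' ex y y' ey; apply: lie_br_congr. Qed.

#[local] Hint Resolve lie_refl : core.

Lemma lie_addr0 (Q : quiver) (x : lie_term Q) : lie_eq (LieAdd x LieZero) x.
Proof. by rewrite lie_addC lie_add0. Qed.

Lemma lie_add_cancel (Q : quiver) (x y z : lie_term Q) :
  lie_eq (LieAdd x z) (LieAdd y z) -> lie_eq x y.
Proof.
move=> e; rewrite -(lie_addr0 x) -(lie_addr0 y) -(lie_addN z) !lie_addA.
by rewrite e.
Qed.

Lemma lie_scaler0 (Q : quiver) c : lie_eq (LieScale c (@LieZero Q)) LieZero.
Proof.
apply: (@lie_add_cancel _ _ _ (LieScale c LieZero)).
by rewrite -lie_scaleDr !lie_add0.
Qed.

Lemma lie_brx0 (Q : quiver) (x : lie_term Q) : lie_eq (LieBr x LieZero) LieZero.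
Proof.
apply: (@lie_add_cancel _ _ _ (LieBr x LieZero)).
by rewrite -lie_brDr !lie_add0.
Qed.

Lemma lie_br0x (Q : quiver) (x : lie_term Q) : lie_eq (LieBr LieZero x) LieZero.
Proof.
apply: (@lie_add_cancel _ _ _ (LieBr LieZero x)).
by rewrite -lie_brDl !lie_add0.
Qed.

Lemma lie_eq_opp (Q : quiver) (x y : lie_term Q) :
  lie_eq (LieAdd x y) LieZero -> lie_eq x (LieScale (-1) y).
Proof.
move=> e; apply: (@lie_add_cancel _ _ _ y).
by rewrite e lie_addC lie_addN.
Qed.

Lemma lie_anti (Q : quiver) (x y : lie_term Q) :
  lie_eq (LieBr x y) (LieScale (-1) (LieBr y x)).
Proof.
apply: lie_eq_opp; have := lie_brxx (LieAdd x y).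
rewrite lie_brDl !lie_brDr !lie_brxx lie_add0 lie_addr0 //.
Qed.

Lemma lie_derivation (Q : quiver) (x y z : lie_term Q) :
  lie_eq (LieBr x (LieBr y z)) (LieAdd (LieBr (LieBr x y) z) (LieBr y (LieBr x z))).
Proof.
have := lie_eq_opp (lie_jacobi x y z) => ->.
rewrite lie_scaleDr lie_addC.
rewrite (lie_anti z) lie_scaleA (_ : -1 * -1 = 1) ?mulrNN ?mulr1 // lie_scale1.
by rewrite (lie_anti z x) lie_brZr lie_scaleA (_ : -1 * -1 = 1) ?mulrNN ?mulr1 // lie_scale1.
Qed.

(** * The triangular decomposition *)

Definition chevalley (Q : quiver) (sg : bool) (i : vertex Q) : lie_term Q :=
  if sg then LieE i else LieF i.

Definition chevalley_deg (Q : quiver) (sg : bool) (i : vertex Q) : lattice Q :=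
  if sg then simple_root i else - simple_root i.

(** The span of the iterated brackets of the [LieE i] if [sg] holds, and of the
    [LieF i] otherwise.  The parameter lets the symmetric arguments be made
    once. *)
Inductive one_sided (Q : quiver) (sg : bool) : lattice Q -> lie_term Q -> Prop :=
  | one_sided_gen i : one_sided sg (chevalley_deg sg i) (chevalley sg i)
  | one_sided_ad i al x : one_sided sg al x ->
      one_sided sg (chevalley_deg sg i + al) (LieBr (chevalley sg i) x)
  | one_sided0 al : one_sided sg al LieZero
  | one_sidedD al x y : one_sided sg al x -> one_sided sg al y ->
      one_sided sg al (LieAdd x y)
  | one_sidedZ al c x : one_sided sg al x -> one_sided sg al (LieScale c x)
  | one_sided_eq al x y : lie_eq x y -> one_sided sg al x -> one_sided sg al y.

(** The span of a one-sided part and of the [LieH i]. *)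
Inductive borel (Q : quiver) (sg : bool) : lattice Q -> lie_term Q -> Prop :=
  | borel_one_sided al x : one_sided sg al x -> borel sg al x
  | borelH i : borel sg 0 (LieH i)
  | borelD al x y : borel sg al x -> borel sg al y -> borel sg al (LieAdd x y)
  | borelZ al c x : borel sg al x -> borel sg al (LieScale c x)
  | borel_eq al x y : lie_eq x y -> borel sg al x -> borel sg al y.

(** The sum of the two Borel subalgebras.  It is stable under bracketing with every
    generator, so it is everything ([lie_homogeneous_triangular]).  The degree is
    carried along because the components of degree [al] are what a root is
    about. *)
Inductive triangular (Q : quiver) : lattice Q -> lie_term Q -> Prop :=
  | triangular_borel sg al x : borel sg al x -> triangular al x
  | triangularD al x y : triangular al x -> triangular al y -> triangular al (LieAdd x y)
  | triangularZ al c x : triangular al x -> triangular al (LieScale c x)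
  | triangular_eq al x y : lie_eq x y -> triangular al x -> triangular al y.

#[local] Instance one_sided_proper (Q : quiver) sg al :
  Proper (@lie_eq Q ==> iff) (@one_sided Q sg al).
Proof. by move=> x y e; split; apply: one_sided_eq; rewrite e. Qed.

#[local] Instance borel_proper (Q : quiver) sg al :
  Proper (@lie_eq Q ==> iff) (@borel Q sg al).
Proof. by move=> x y e; split; apply: borel_eq; rewrite e. Qed.

#[local] Instance triangular_proper (Q : quiver) al :
  Proper (@lie_eq Q ==> iff) (@triangular Q al).
Proof. by move=> x y e; split; apply: triangular_eq; rewrite e. Qed.

Lemma lie_H_chevalley (Q : quiver) sg (i j : vertex Q) :
  exists c, lie_eq (LieBr (LieH i) (chevalley sg j)) (LieScale c (chevalley sg j)).
Proof.
case: sg; first by exists (cartan_entry i j)%:~R; apply: lie_HE.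
by exists (- (cartan_entry i j)%:~R); apply: lie_HF.
Qed.

Lemma one_sided_H (Q : quiver) sg (al : lattice Q) x i :
  one_sided sg al x -> one_sided sg al (LieBr (LieH i) x).
Proof.
elim=> {al x} [j|j al x xp IH|al|al x y _ IHx _ IHy|al c x _ IH|al x y e _ IH].
- by have [c ->] := lie_H_chevalley sg i j; apply: one_sidedZ; apply: one_sided_gen.
- rewrite lie_derivation; apply: one_sidedD; last exact: one_sided_ad.
  have [c ->] := lie_H_chevalley sg i j.
  by rewrite lie_brZl; apply: one_sidedZ; apply: one_sided_ad.
- by rewrite lie_brx0; apply: one_sided0.
- by rewrite lie_brDr; apply: one_sidedD.
- by rewrite lie_brZr; apply: one_sidedZ.
- by rewrite -e.
Qed.

Lemma borel_H (Q : quiver) sg (al : lattice Q) x i :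
  borel sg al x -> borel sg al (LieBr (LieH i) x).
Proof.
elim=> {al x} [al x xp|j|al x y _ IHx _ IHy|al c x _ IH|al x y e _ IH].
- by apply: borel_one_sided; apply: one_sided_H.
- by rewrite lie_HH; apply: borel_one_sided; apply: one_sided0.
- by rewrite lie_brDr; apply: borelD.
- by rewrite lie_brZr; apply: borelZ.
- by rewrite -e.
Qed.

Lemma one_sided_chevalley_H (Q : quiver) sg (i j : vertex Q) :
  one_sided sg (chevalley_deg sg j + 0) (LieBr (chevalley sg j) (LieH i)).
Proof.
have [c e] := lie_H_chevalley sg i j.
by rewrite addr0 lie_anti e; do 2 apply: one_sidedZ; apply: one_sided_gen.
Qed.

Lemma borel_ad_same (Q : quiver) sg (al : lattice Q) x j :
  borel sg al x -> one_sided sg (chevalley_deg sg j + al) (LieBr (chevalley sg j) x).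
Proof.
elim=> {al x} [al x xp|i|al x y _ IHx _ IHy|al c x _ IH|al x y e _ IH].
- exact: one_sided_ad.
- exact: one_sided_chevalley_H.
- by rewrite lie_brDr; apply: one_sidedD.
- by rewrite lie_brZr; apply: one_sidedZ.
- by rewrite -e.
Qed.

Lemma chevalley_opposite (Q : quiver) sg (i j : vertex Q) :
  (i = j /\ exists c, lie_eq (LieBr (chevalley (~~ sg) i) (chevalley sg j))
                       (LieScale c (LieH i))) \/
  lie_eq (LieBr (chevalley (~~ sg) i) (chevalley sg j)) LieZero.
Proof.
case: (eqVneq i j) => [<-|ij]; [left; split=> // | right].
  case: sg => /=; last by exists 1; rewrite lie_EF lie_scale1.
  by exists (-1); rewrite lie_anti lie_EF.
case: sg => /=; last exact: lie_EF0.
by rewrite lie_anti lie_EF0 1?eq_sym // lie_scaler0.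
Qed.

Lemma chevalley_degK (Q : quiver) sg (i : vertex Q) al :
  chevalley_deg (~~ sg) i + (chevalley_deg sg i + al) = al.
Proof. by case: sg; rewrite /= ?addKr // addNKr. Qed.

(** The bracket of opposite generators lies in the Cartan subalgebra, which
    preserves the one-sided part; the rest is the derivation rule. *)
Lemma one_sided_ad_opposite (Q : quiver) sg (al : lattice Q) x i :
  one_sided sg al x -> borel sg (chevalley_deg (~~ sg) i + al) (LieBr (chevalley (~~ sg) i) x).
Proof.
elim=> {al x} [j|j al x xp IH|al|al x y _ IHx _ IHy|al c x _ IH|al x y e _ IH].
- have [[<- [c ->]]|->] := chevalley_opposite sg i j; last first.
    by apply: borel_one_sided; apply: one_sided0.
  by rewrite -[chevalley_deg sg i]addr0 chevalley_degK; apply: borelZ; apply: borelH.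
- rewrite lie_derivation; apply: borelD; last first.
    by rewrite addrCA; apply: borel_one_sided; apply: borel_ad_same.
  have [[<- [c ->]]|->] := chevalley_opposite sg i j.
    rewrite chevalley_degK lie_brZl; apply: borelZ.
    by apply: borel_one_sided; apply: one_sided_H.
  by rewrite lie_br0x; apply: borel_one_sided; apply: one_sided0.
- by rewrite lie_brx0; apply: borel_one_sided; apply: one_sided0.
- by rewrite lie_brDr; apply: borelD.
- by rewrite lie_brZr; apply: borelZ.
- by rewrite -e.
Qed.

Lemma borel_ad_opposite (Q : quiver) sg (al : lattice Q) x i :
  borel sg al x -> triangular (chevalley_deg (~~ sg) i + al) (LieBr (chevalley (~~ sg) i) x).
Proof.
elim=> {al x} [al x xp|j|al x y _ IHx _ IHy|al c x _ IH|al x y e _ IH].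
- by apply: (triangular_borel (sg := sg)); apply: one_sided_ad_opposite.
- apply: (triangular_borel (sg := ~~ sg)); apply: borel_one_sided.
  exact: one_sided_chevalley_H.
- by rewrite lie_brDr; apply: triangularD.
- by rewrite lie_brZr; apply: triangularZ.
- by rewrite -e.
Qed.

Lemma triangular_ad (Q : quiver) sg (al : lattice Q) x i :
  triangular al x -> triangular (chevalley_deg sg i + al) (LieBr (chevalley sg i) x).
Proof.
elim=> {al x} [sg' al x xb|al x y _ IHx _ IHy|al c x _ IH|al x y e _ IH].
- have [->|sg_opp] := eqVneq sg sg'.
    apply: (triangular_borel (sg := sg')); apply: borel_one_sided.
    exact: borel_ad_same.
  have -> : sg = ~~ sg' by case: sg sg' sg_opp {xb} => [] [].
  exact: borel_ad_opposite.
- by rewrite lie_brDr; apply: triangularD.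
- by rewrite lie_brZr; apply: triangularZ.
- by rewrite -e.
Qed.

Lemma triangular_H (Q : quiver) (al : lattice Q) x i :
  triangular al x -> triangular al (LieBr (LieH i) x).
Proof.
elim=> {al x} [sg' al x xb|al x y _ IHx _ IHy|al c x _ IH|al x y e _ IH].
- by apply: (triangular_borel (sg := sg')); apply: borel_H.
- by rewrite lie_brDr; apply: triangularD.
- by rewrite lie_brZr; apply: triangularZ.
- by rewrite -e.
Qed.

Lemma triangular_zero (Q : quiver) (al : lattice Q) : triangular al LieZero.
Proof.
by apply: (triangular_borel (sg := true)); apply: borel_one_sided; apply: one_sided0.
Qed.

(** The elements whose bracket preserves the triangular part form a subalgebra that
    contains the generators. *)
Lemma lie_homogeneous_triangular (Q : quiver) (al : lattice Q) x :
  lie_homogeneous al x ->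
  triangular al x /\
  forall be y, triangular be y -> triangular (al + be) (LieBr x y).
Proof.
have gen sg (i : vertex Q) : triangular (chevalley_deg sg i) (chevalley sg i).
  by apply: (triangular_borel (sg := sg)); apply: borel_one_sided; apply: one_sided_gen.
elim=> {al x} [i|i|i|al|al x y _ [xt IHx] _ [yt IHy]|al c x _ [xt IH]|al be x y _ [xt IHx] _ [yt IHy]].
- by split=> [|be y yt]; [apply: (gen true) | apply: (triangular_ad true)].
- by split=> [|be y yt]; [apply: (gen false) | apply: (triangular_ad false)].
- split=> [|be y yt]; last by rewrite add0r; apply: triangular_H.
  by apply: (triangular_borel (sg := true)); apply: borelH.
- by split=> [|be y yt]; rewrite ?lie_br0x; apply: triangular_zero.
- split=> [|be z zt]; first exact: triangularD.
  by rewrite lie_brDl; apply: triangularD; [apply: IHx | apply: IHy].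
- split=> [|be z zt]; first exact: triangularZ.
  by rewrite lie_brZl; apply: triangularZ; apply: IH.
- split=> [|ga z zt]; first exact: IHx.
  have e : lie_eq (LieBr (LieBr x y) z)
     (LieAdd (LieBr x (LieBr y z)) (LieScale (-1) (LieBr y (LieBr x z)))).
    by rewrite lie_derivation -lie_addA lie_addN lie_addr0.
  rewrite e; apply: triangularD; first by rewrite -addrA; apply: IHx; apply: IHy.
  by apply: triangularZ; rewrite -addrA addrCA; apply: IHy; apply: IHx.
Qed.

(** * Roots have connected support *)

Lemma borel_nonzero_deg (Q : quiver) sg (al : lattice Q) x :
  borel sg al x -> al != 0 -> one_sided sg al x.
Proof.
elim=> {al x} [al x xp|j|al x y _ IHx _ IHy|al c x _ IH|al x y e _ IH] // al0.
- by rewrite eqxx in al0.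
- by apply: one_sidedD; [apply: IHx | apply: IHy].
- by apply: one_sidedZ; apply: IH.
- by rewrite -e; apply: IH.
Qed.

Lemma triangular_split (Q : quiver) (al : lattice Q) x :
  triangular al x -> al != 0 ->
  exists y z, [/\ lie_eq x (LieAdd y z), one_sided true al y & one_sided false al z].
Proof.
move=> xt al0; elim: xt al0 => {al x} [sg al x xb|al x y _ IHx _ IHy|al c x _ IH|al x y e _ IH] al0.
- have xo := borel_nonzero_deg xb al0; case: sg xo {xb} => xo.
    exists x, LieZero; split; [by rewrite lie_addr0 | by [] | exact: one_sided0].
  exists LieZero, x; split; [by rewrite lie_add0 | exact: one_sided0 | by []].
- have [x1 [x2 [ex px nx]]] := IHx al0; have [y1 [y2 [ey py ny]]] := IHy al0.
  exists (LieAdd x1 y1), (LieAdd x2 y2); split; [|exact: one_sidedD|exact: one_sidedD].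
  by rewrite ex ey -!lie_addA (lie_addA y1) (lie_addC y1 x2) !lie_addA.
- have [x1 [x2 [ex px nx]]] := IH al0.
  exists (LieScale c x1), (LieScale c x2); split; [|exact: one_sidedZ|exact: one_sidedZ].
  by rewrite ex lie_scaleDr.
- by have [x1 [x2 [ex px nx]]] := IH al0; exists x1, x2; split=> //; rewrite -e.
Qed.

Lemma one_sided_sign (Q : quiver) sg (al : lattice Q) x :
  one_sided sg al x ->
  lie_eq x LieZero \/
  ((forall i, 0 <= (if sg then al i else - al i)) /\
   (exists i, 0 < (if sg then al i else - al i))).
Proof.
have deg (i k : vertex Q) : (if sg then chevalley_deg sg i k else - chevalley_deg sg i k) =
    (i == k)%:Z by case: (sg); rewrite !ffunE ?opprK.
have degD (i : vertex Q) (be : lattice Q) k :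
    (if sg then (chevalley_deg sg i + be) k else - (chevalley_deg sg i + be) k) =
    (i == k)%:Z + (if sg then be k else - be k).
  by rewrite -(deg i k); case: (sg) => /=; rewrite !ffunE ?opprD.
elim=> {al x} [j|j al x xp IH|al|al x y _ IHx _ IHy|al c x _ IH|al x y e _ IH].
- by right; split; [move=> i; rewrite deg | exists j; rewrite deg eqxx].
- case: IH => [->|[al0 _]]; first by left; rewrite lie_brx0.
  right; split=> [i|]; first by rewrite degD addr_ge0.
  by exists j; rewrite degD eqxx ltr_pwDl.
- by left.
- case: IHx => [->|H]; last by right.
  by case: IHy => [->|H]; [left; rewrite lie_add0 | right].
- by case: IH => [->|H]; [left; rewrite lie_scaler0 | right].
- by case: IH => [e0|H]; [left; rewrite -e | right].
Qed.

(** For [cartan_entry i k = 0] the Serre relation says that [LieE i] and [LieE k]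
    commute. *)
Lemma one_sided_commute (Q : quiver) (al : lattice Q) x (i : vertex Q) :
  one_sided true al x ->
  (forall k, al k != 0 -> i != k /\ cartan_entry i k = 0) ->
  lie_eq (LieBr (LieE i) x) LieZero.
Proof.
elim=> {al x} [j|j al x xp IH|al|al x y _ IHx _ IHy|al c x _ IH|al x y e _ IH] H.
- have [|ij cij] := H j; first by rewrite ffunE eqxx.
  by have := lie_serreE ij; rewrite cij subr0.
- have [->|[al0 _]] := one_sided_sign xp; first by rewrite !lie_brx0.
  have pos k : (simple_root j + al) k = (j == k)%:Z + al k by rewrite !ffunE.
  have [|ij cij] := H j.
    by rewrite /= pos eqxx gt_eqF // ltr_pwDl // al0.
  rewrite lie_derivation IH => [|k ak]; last first.
    by apply: H; rewrite /= pos gt_eqF // ltr_wpDl // lt_def ak al0.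
  by have := lie_serreE ij; rewrite cij subr0 /= => ->; rewrite lie_br0x lie_brx0 lie_add0.
- exact: lie_brx0.
- by rewrite lie_brDr IHx // IHy // lie_add0.
- by rewrite lie_brZr IH // lie_scaler0.
- by rewrite -e; apply: IH.
Qed.

(** Within a support [D] cut into two sides without edges between them, an iterated
    bracket that involves both sides vanishes: at the innermost place where the
    side changes, a generator commutes with everything inside. *)
Lemma one_sided_support (Q : quiver) (D S : {set vertex Q}) (al : lattice Q) x :
  (forall i j, i \in S -> j \notin S -> i \in D -> j \in D -> cartan_entry i j = 0) ->
  one_sided true al x -> (forall k, al k != 0 -> k \in D) ->
  lie_eq x LieZero \/ (forall k, al k != 0 -> k \in S) \/ (forall k, al k != 0 -> k \notin S).
Proof.
move=> HS.
elim=> {al x} [j|j al x xp IH|al|al x y _ IHx _ IHy|al c x _ IH|al x y e _ IH] H.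
- right; have [jS|jS] := boolP (j \in S); [left|right] => k;
    by rewrite ffunE; case: (eqVneq j k) => // <-.
- have [->|[al0 _]] := one_sided_sign xp; first by left; rewrite lie_brx0.
  have pos k : (simple_root j + al) k = (j == k)%:Z + al k by rewrite !ffunE.
  have jD : j \in D by apply: H; rewrite /= pos eqxx gt_eqF // ltr_pwDl // al0.
  have aD k : al k != 0 -> k \in D.
    by move=> ak; apply: H; rewrite /= pos gt_eqF // ltr_wpDl // lt_def ak al0.
  have supp_cases k : (simple_root j + al) k != 0 -> k = j \/ al k != 0.
    by rewrite pos; case: (eqVneq j k) => [->|_]; [left | rewrite add0r; right].
  have [->|[aS|aS]] := IH aD; first by left; rewrite lie_brx0.
    have [jS|jS] := boolP (j \in S).
      by right; left=> k /supp_cases[->|/aS].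
    left; apply: one_sided_commute xp _ => k ak; split.
      by apply: contraNneq jS => ->; apply: aS.
    by rewrite cartan_entryC; apply: HS => //; [apply: aS | apply: aD].
  have [jS|jS] := boolP (j \in S); last by right; right=> k /supp_cases[->|/aS].
  left; apply: one_sided_commute xp _ => k ak; split.
    by apply: contraTneq jS => ->; apply: aS.
  by apply: HS => //; [apply: aS | apply: aD].
- by left.
- have [->|Hx] := IHx H; last by right.
  by have [->|Hy] := IHy H; [left; rewrite lie_add0 | right].
- by have [->|Hx] := IH H; [left; rewrite lie_scaler0 | right].
- by have [e0|Hx] := IH H; [left; rewrite -e | right].
Qed.

(** A nonzero element whose degree is positive is a combination of iterated
    brackets of the [LieE i]. *)
Lemma root_support_connected (Q : quiver) (delta : dimvec Q) :
  is_root (to_lattice delta) -> support_connected delta.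
Proof.
move=> [d0 [x [xh x0]]] S HS.
have [xt _] := lie_homogeneous_triangular xh.
have [y [z [e yp zn]]] := triangular_split xt d0.
have z0 : lie_eq z LieZero.
  have [//|[_ [i]]] := one_sided_sign zn.
  by rewrite ffunE oppr_gt0.
rewrite e z0 lie_addr0 in x0.
have dE k : (to_lattice delta k != 0) = (delta k != 0%N) by rewrite ffunE.
have := one_sided_support (D := [set i | delta i != 0%N]) (S := S) _ yp.
case=> [i j iS jS|k|//|[H|H]].
- by rewrite !inE; apply: HS.
- by rewrite dE inE.
- by left=> i di; apply: H; rewrite dE.
- by right=> i di; apply: H; rewrite dE.
Qed.

(** * Polynomials read from the leading coefficient *)

(** Otherwise the leading term dominates at large arguments. *)
Lemma size_le_of_growth (E : {poly rat}) (C B : nat) :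
  (forall n : nat, exists2 q : nat, (n <= q)%N & `|E.[q%:R]| <= (C * q ^ B)%:R) ->
  (size E <= B.+1)%N.
Proof.
move=> H; rewrite leqNgt; apply/negP=> sE.
set s := (size E).-1; have sEs : size E = s.+1 by rewrite /s; lia.
have Bs : (B <= s.-1)%N by lia.
have s0 : (0 < s)%N by lia.
set c := E`_s; have c0 : c != 0.
  by rewrite /c /s -lead_coefE lead_coef_eq0 -size_poly_eq0 sEs.
pose K : rat := \sum_(i < s) `|E`_i|.
have K0 : 0 <= K by apply: sumr_ge0 => i _; apply: normr_ge0.
(* Beyond [b] the leading term exceeds the sum of the bound and the others. *)
pose b := Num.bound ((C%:R + K) / `|c|).
have [q bq Eq] := H b.+1.
have q1 : 1 <= q%:R :> rat by rewrite ler1n; lia.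
have bigq : C%:R + K < `|c| * q%:R.
  rewrite mulrC -ltr_pdivrMr ?normr_gt0 //.
  apply: lt_le_trans (archi_boundP _) _; first by rewrite divr_ge0 ?addr_ge0 ?ler0n.
  by rewrite ler_nat; apply: leq_trans bq; rewrite /b.
have Eexp : E.[q%:R] = \sum_(i < s) E`_i * q%:R ^+ i + c * q%:R ^+ s.
  by rewrite horner_coef sEs big_ord_recr.
have low : `|\sum_(i < s) E`_i * q%:R ^+ i| <= K * q%:R ^+ s.-1.
  apply: le_trans (ler_norm_sum _ _ _) _; rewrite /K mulr_suml.
  apply: ler_sum => i _; rewrite normrM ler_wpM2l // ger0_norm ?exprn_ge0 ?ler0n //.
  by rewrite ler_weXn2l //; have := ltn_ord i; lia.
have top : `|c| * q%:R ^+ s <= (C%:R + K) * q%:R ^+ s.-1.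
  have -> : `|c| * q%:R ^+ s = `|c * q%:R ^+ s|.
    by rewrite normrM (ger0_norm (exprn_ge0 _ (ler0n _ _))).
  have -> : c * q%:R ^+ s = E.[q%:R] - \sum_(i < s) E`_i * q%:R ^+ i.
    by rewrite Eexp addrAC subrr add0r.
  apply: le_trans (ler_normB _ _) _; rewrite mulrDl lerD //.
  apply: le_trans Eq _; rewrite natrM natrX ler_wpM2l ?ler0n //.
  by rewrite ler_weXn2l.
move: top; rewrite -{1}(prednK s0) exprS mulrA ler_pM2r ?exprn_gt0 //; last first.
  by rewrite (lt_le_trans ltr01).
by rewrite leNgt bigq.
Qed.

(** For [p] of degree at most [a] this is [X^a p(1/X)], whose low coefficients are
    the top ones of [p]. *)
Definition reversal (a : nat) (p : {poly rat}) : {poly rat} :=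
  \sum_(i < a.+1) p`_i *: 'X^(a - i).

Lemma reversalD a : {morph reversal a : p q / p + q}.
Proof. by move=> p q; rewrite -big_split; apply: eq_bigr => i _; rewrite coefD scalerDl. Qed.

Lemma reversalZ a c p : reversal a (c *: p) = c *: reversal a p.
Proof. by rewrite /reversal scaler_sumr; apply: eq_bigr => i _; rewrite coefZ scalerA. Qed.

Lemma reversal0 a : reversal a 0 = 0.
Proof. by rewrite /reversal big1 // => i _; rewrite coef0 scale0r. Qed.

Lemma reversalXn a n : (n <= a)%N -> reversal a 'X^n = 'X^(a - n).
Proof.
move=> na; rewrite /reversal (bigD1 (Ordinal (na : n < a.+1)%N)) //= coefXn eqxx scale1r.
rewrite big1 ?addr0 // => i ni; rewrite coefXn (_ : _ == n = false) ?scale0r //.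
by apply: contraNF ni => /eqP e; apply/eqP/val_inj.
Qed.

Lemma coef_reversal a p k : (reversal a p)`_k = if (k <= a)%N then p`_(a - k) else 0.
Proof.
rewrite coef_sum; case: leqP => ka.
  have h : (a - k < a.+1)%N by lia.
  rewrite (bigD1 (Ordinal h)) //= big1 ?addr0 => [|i ik].
    by rewrite coefZ coefXn subKn // eqxx mulr1.
  rewrite coefZ coefXn (_ : _ == _ = false) ?mulr0 //.
  apply: contraNF ik => /eqP e; apply/eqP/val_inj => /=; have := ltn_ord i; lia.
apply: big1 => i _; rewrite coefZ coefXn (_ : _ == _ = false) ?mulr0 //.
by apply/eqP; lia.
Qed.

Lemma reversalM a b (p q : {poly rat}) : (size p <= a.+1)%N -> (size q <= b.+1)%N ->
  reversal (a + b) (p * q) = reversal a p * reversal b q.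
Proof.
move=> sp sq.
have expand (n : nat) (r : {poly rat}) : (size r <= n)%N -> r = \sum_(i < n) r`_i *: 'X^i.
  by move=> sr; rewrite -poly_def; apply/polyP=> i; rewrite coef_poly;
    case: ltnP => // ni; rewrite nth_default // (leq_trans sr).
rewrite {1}(expand _ _ sp) {1}(expand _ _ sq) mulr_suml.
rewrite (big_morph _ (@reversalD _) (@reversal0 _)) /reversal mulr_suml.
apply: eq_bigr => i _; rewrite mulr_sumr.
rewrite -/(reversal _ _) (big_morph _ (@reversalD _) (@reversal0 _)) mulr_sumr.
apply: eq_bigr => j _.
rewrite -!scalerAl -!scalerAr !reversalZ -!exprD reversalXn; last first.
  by have := ltn_ord i; have := ltn_ord j; lia.
congr (_ *: (_ *: 'X^_)); have := ltn_ord i; have := ltn_ord j; lia.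
Qed.

Definition has_reversal (a : nat) (p r : {poly rat}) : Prop :=
  (size p <= a.+1)%N /\ reversal a p = r.

Lemma has_reversalM a b p q r s :
  has_reversal a p r -> has_reversal b q s -> has_reversal (a + b) (p * q) (r * s).
Proof.
move=> [sp <-] [sq <-]; split; last exact: reversalM.
by apply: leq_trans (size_polyMleq _ _) _; lia.
Qed.

Lemma has_reversal_prod (I : Type) (t : seq I) (P : pred I) (a : I -> nat)
    (p r : I -> {poly rat}) :
  (forall i, P i -> has_reversal (a i) (p i) (r i)) ->
  has_reversal (\sum_(i <- t | P i) a i) (\prod_(i <- t | P i) p i) (\prod_(i <- t | P i) r i).
Proof.
move=> H; elim: t => [|i t IH].
  by rewrite !big_nil; split; [rewrite size_poly1 | exact: (@reversalXn 0 0)].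
by rewrite !big_cons; case: ifP => // Pi; apply: has_reversalM => //; apply: H.
Qed.

Lemma has_reversalXn n : has_reversal n 'X^n 1.
Proof. by split; [rewrite size_polyXn | rewrite reversalXn // subnn expr0]. Qed.

Lemma reversalN a p : reversal a (- p) = - reversal a p.
Proof. by rewrite -scaleN1r reversalZ scaleN1r. Qed.

Lemma has_reversalXnB1 k : (0 < k)%N -> has_reversal k ('X^k - 1) (1 - 'X^k).
Proof.
move=> k0; split; first by rewrite size_XnsubC.
by rewrite reversalD reversalN -(expr0 'X) !reversalXn // subnn subn0.
Qed.

Definition gl_poly (I : finType) (v : I -> nat) : {poly rat} :=
  \prod_i ('X^('C(v i, 2)) * \prod_(1 <= k < (v i).+1) ('X^k - 1)).

Definition gl_degree (I : finType) (v : I -> nat) : nat :=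
  (\sum_i ('C(v i, 2) + \sum_(1 <= k < (v i).+1) k))%N.

Definition qfact (n : nat) : {poly rat} := \prod_(1 <= k < n.+1) (1 - 'X^k).

Lemma gl_poly_reversal (I : finType) (v : I -> nat) :
  has_reversal (gl_degree v) (gl_poly v) (\prod_i qfact (v i)).
Proof.
apply: has_reversal_prod => i _; rewrite -[qfact _]mul1r.
apply: has_reversalM; first exact: has_reversalXn.
rewrite /qfact !big_nat; apply: has_reversal_prod => k /andP[k1 _].
exact: has_reversalXnB1.
Qed.

Lemma coef0_prod (I : Type) (t : seq I) (P : pred I) (p : I -> {poly rat}) :
  (forall i, P i -> (p i)`_0 = 1) -> (\prod_(i <- t | P i) p i)`_0 = 1.
Proof.
move=> H; elim/big_ind: _ => // [|x y ex ey]; first by rewrite coef1.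
by rewrite coefM big_ord1 ex ey mulr1.
Qed.

Lemma coef0_qfact n : (qfact n)`_0 = 1.
Proof.
rewrite /qfact big_nat; apply: coef0_prod => k /andP[k1 _].
by rewrite coefB coef1 coefXn (ltn_eqF k1) subr0.
Qed.

(** * Truncated power series *)

Definition eq_below (m : nat) (p q : {poly rat}) : Prop :=
  forall k, (k < m)%N -> p`_k = q`_k.

Lemma eq_below_refl m p : eq_below m p p. Proof. by []. Qed.

Lemma eq_below_sym m p q : eq_below m p q -> eq_below m q p.
Proof. by move=> H k km; rewrite H. Qed.

Lemma eq_below_trans m p q r : eq_below m p q -> eq_below m q r -> eq_below m p r.
Proof. by move=> H1 H2 k km; rewrite H1 // H2. Qed.

Lemma eq_belowM m p q r s :
  eq_below m p q -> eq_below m r s -> eq_below m (p * r) (q * s).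
Proof.
move=> H1 H2 k km; rewrite !coefM; apply: eq_bigr => i _.
by rewrite H1 ?H2 //; have := ltn_ord i; lia.
Qed.

Lemma eq_below_prod (I : Type) m (t : seq I) (P : pred I) (p q : I -> {poly rat}) :
  (forall i, P i -> eq_below m (p i) (q i)) ->
  eq_below m (\prod_(i <- t | P i) p i) (\prod_(i <- t | P i) q i).
Proof.
move=> H; elim/big_ind2: _ => // p1 q1 p2 q2 e1 e2; exact: eq_belowM.
Qed.

Lemma eq_below_cancel m (p q g : {poly rat}) :
  g`_0 = 1 -> eq_below m (p * g) (q * g) -> eq_below m p q.
Proof.
move=> g0 H k; elim/ltn_ind: k => k IH km.
have := H k km; rewrite !coefM !big_ord_recr /= subnn g0 !mulr1.
rewrite (eq_bigr (fun i : 'I_k => q`_i * g`_(k - i))); first by move/addrI.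
by move=> i _; rewrite IH // (ltn_trans _ km).
Qed.

Lemma qfact_stable m n : (m <= n)%N -> eq_below m.+1 (qfact n) (qfact m).
Proof.
move=> mn; rewrite /qfact (@big_cat_nat _ _ _ m.+1) //=.
rewrite -[X in eq_below _ _ X]mulr1; apply: eq_belowM; first exact: eq_below_refl.
rewrite [X in eq_below _ X]big_nat.
apply: (@eq_below_trans _ _ (\prod_(m.+1 <= i < n.+1 | (m.+1 <= i < n.+1)%N) 1)).
  2: by rewrite big1.
apply: eq_below_prod => i /andP[mi _] k km.
by rewrite coefB coefXn (_ : _ == _ = false) ?subr0 //; apply/eqP; lia.
Qed.

Lemma size_fps_div_prefix f g n : size (fps_div_prefix f g n) = n.
Proof. by elim: n => //= n IH; rewrite size_rcons IH. Qed.

Lemma nth_fps_div_prefix f g n k : (k < n)%N -> (fps_div_prefix f g n)`_k = fps_div f g k.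
Proof.
elim: n => // n IH kn; rewrite /fps_div.
have [e|kn'] := eqVneq k n; first by rewrite e.
have {}kn : (k < n)%N by lia.
by rewrite {1}/fps_div_prefix -/fps_div_prefix nth_rcons size_fps_div_prefix kn IH.
Qed.

Lemma fps_div_rec f g n :
  fps_div f g n = (f n - \sum_(k < n) fps_div f g k * g (n - k)%N) / g 0%N.
Proof.
rewrite {1}/fps_div /= nth_rcons size_fps_div_prefix ltnn eqxx.
congr ((_ - _) / _); apply: eq_bigr => k _.
by rewrite nth_fps_div_prefix.
Qed.

Lemma fps_divK f g n : g 0%N = 1 -> fps_mul (fps_div f g) g n = f n.
Proof.
move=> g0; rewrite /fps_mul big_ord_recr /= subnn g0 mulr1 (fps_div_rec f g n) g0 divr1.
by rewrite addrC subrK.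
Qed.

Lemma fps_div_ext f g h n : (forall k, (k <= n)%N -> g k = h k) -> fps_div f g n = fps_div f h n.
Proof.
elim/ltn_ind: n => n IH H; rewrite !fps_div_rec H //.
congr ((_ - _) / _); apply: eq_bigr => k _.
rewrite IH ?H ?leq_subr // => j jk; apply: H; have := ltn_ord k; lia.
Qed.

Definition truncation (m : nat) (f : fps) : {poly rat} := \poly_(k < m) f k.

Lemma truncationM m f (p : {poly rat}) k : (k < m)%N ->
  (truncation m f * p)`_k = fps_mul f (fps_of_poly p) k.
Proof.
move=> km; rewrite coefM; apply: eq_bigr => i _; rewrite coef_poly.
by have -> : (i < m)%N by have := ltn_ord i; lia.
Qed.

(** Below degree [m + 1] the product over [k <= v i] may be replaced by that over
    [k <= j] for the coefficient of degree [j], which is how the series is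
    defined. *)
Lemma colored_partition_inverse (I : finType) (S : {set I}) (v : I -> nat) m :
  (forall i, i \in S -> (m <= v i)%N) ->
  eq_below m.+1 (truncation m.+1 (colored_partition_series #|S|) *
               \prod_(i in S) qfact (v i)) 1.
Proof.
move=> mv; set D := \prod_(i in S) _.
have D0 : fps_of_poly D 0%N = 1 by apply: coef0_prod => i _; apply: coef0_qfact.
move=> k km; rewrite truncationM // -[RHS](fps_divK (fps_of_poly 1) k D0).
apply: eq_bigr => j _; congr (_ * _); apply: fps_div_ext => l lj.
have jk := ltn_ord j.
rewrite /fps_of_poly prodrXl -/(qfact j).
have -> : qfact j ^+ #|S| = \prod_(i in S) qfact j by rewrite prodr_const.
apply: (@eq_below_sym j.+1); last by lia.
by apply: eq_below_prod => i iS; apply: qfact_stable; have := mv i iS; lia.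
Qed.

Definition stable_series (I : finType) (S : {set I}) (d : I -> nat) : fps :=
  fps_div (fps_mul (fps_of_poly (1 - 'X)) (colored_partition_series #|S|))
    (fps_of_poly (\prod_(i | i \notin S) qfact (d i))).

(** Multiplied by the product of the [qfact (v i)], both sides become [1 - 'X] below
    degree [m + 1], and this product can be cancelled. *)
Lemma stable_series_unique (I : finType) (S : {set I}) (d v : I -> nat) m (p : {poly rat}) :
  (forall i, i \in S -> (m <= v i)%N) -> (forall i, i \notin S -> v i = d i) ->
  eq_below m.+1 (p * \prod_i qfact (v i)) (1 - 'X) ->
  forall k, (k <= m)%N -> p`_k = stable_series S d k.
Proof.
move=> mv vd pv k km.
pose D1 := \prod_(i | i \notin S) qfact (d i); pose D2 := \prod_(i in S) qfact (v i).
have D10 : D1`_0 = 1 by apply: coef0_prod => i _; apply: coef0_qfact.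
have D20 : D2`_0 = 1 by apply: coef0_prod => i _; apply: coef0_qfact.
have DE : \prod_i qfact (v i) = D1 * D2.
  rewrite (bigID (mem S)) /= mulrC; congr (_ * _).
  by apply: eq_bigr => i iS; rewrite vd.
pose A := truncation m.+1 (stable_series S d).
pose Cp := truncation m.+1 (colored_partition_series #|S|).
have AD : eq_below m.+1 (A * D1) (Cp * (1 - 'X)).
  move=> j jm; rewrite truncationM // fps_divK //.
  rewrite mulrC coefM; apply: eq_bigr => i _; rewrite coef_poly.
  by rewrite (_ : (j - i < m.+1)%N) //; lia.
have {}AD : eq_below m.+1 (A * (D1 * D2)) (1 - 'X).
  rewrite mulrA; apply: eq_below_trans (eq_belowM AD (eq_below_refl D2)) _.
  rewrite mulrAC -[X in eq_below _ _ X]mul1r.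
  by apply: eq_belowM (eq_below_refl _); apply: colored_partition_inverse.
have -> : stable_series S d k = A`_k by rewrite coef_poly ltnS km.
have D120 : (D1 * D2)`_0 = 1 by rewrite coefM big_ord1 D10 D20 mulr1.
apply: (eq_below_cancel D120 _ (km : (k < m.+1)%N)).
by rewrite -DE in AD *; apply: eq_below_trans pv (eq_below_sym AD).
Qed.

(** * Stabilization *)

Lemma gl_poly_eval (Q : quiver) (v : dimvec Q) (q : nat) : (0 < q)%N ->
  (gl_poly v).[q%:R] = (gl_order v q)%:R.
Proof.
move=> q0; rewrite /gl_poly /gl_order horner_prod natr_prod; apply: eq_bigr => i _.
rewrite hornerM hornerXn natrM natrX; congr (_ * _).
rewrite horner_prod natr_prod; apply: eq_bigr => k _.
by rewrite hornerD hornerN hornerXn hornerC natrB ?natrX // expn_gt0 q0.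
Qed.

(** The counts over the prime fields suffice, as there are arbitrarily large
    primes. *)
Lemma kac_error_bound (Q : quiver) (v : dimvec Q) (P : {poly rat}) (m : nat) :
  indivisible v -> is_kac_polynomial v P ->
  (m <= apair v v)%N -> decomposition_bound 2 v (apair v v - m) ->
  (size (P * gl_poly v - ('X - 1) * 'X^(apair v v))%R <= (apair v v - m).+2)%N.
Proof.
move=> vi kacP mv dB; set B := (apair v v - m)%N in dB *.
have [C1 bI] := nontrivial_idempotent_pairs_bound dB.
have [C2 bN] := nonzero_nilpotent_pairs_bound dB.
apply: (@size_le_of_growth _ (C1 + C2)) => n.
have [p np pp] := prime_above n; exists p; first exact: ltnW.
have cF : #|'F_p| = p by apply: card_Fp.
have [lo hi] := @num_abs_indecomposable_bounds Q 'F_p v vi.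
move: lo hi (bI 'F_p) (bN 'F_p); rewrite cF.
set X := num_abs_indecomposable 'F_p v; set I := #|_|; set N := #|_| => lo hi hI hN.
have p0 := prime_gt0 pp.
have PE : P.[p%:R] = X%:R by have := kacP 'F_p; rewrite cF.
rewrite hornerD hornerN !hornerM gl_poly_eval // PE hornerXn hornerD hornerN hornerX hornerC.
set g := gl_order v p in lo hi *; set R := (p ^ apair v v)%N in lo hi *.
have -> : (p%:R - 1) * p%:R ^+ apair v v = ((p - 1) * R)%:R :> rat.
  by rewrite natrM natrB // natrX.
rewrite -natrM.
have IN : (p * (I + N) <= (C1 + C2) * p ^ B.+1)%N.
  by rewrite expnS mulnCA leq_mul2l mulnDl leq_add ?orbT.
rewrite ler_norml; apply/andP; split.
  rewrite lerBrDr addrC lerBlDr -natrD ler_nat; apply: leq_trans lo _.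
  rewrite leq_add2l; apply: leq_trans IN; rewrite leq_mul2r leq_subr orbT //.
rewrite lerBlDr -natrD ler_nat; apply: leq_trans hi _; rewrite addnC leq_add2r.
apply: leq_trans IN; rewrite leq_mul2l leq_addl orbT //.
Qed.

(** The leading term of [P * gl_poly v] is that of [('X - 1) * 'X^rho], which fixes
    the degree of [P]; reversal then turns the identity into one for power
    series, with an error in degrees above [m]. *)
Lemma top_coef_stable (Q : quiver) (d v : dimvec Q) (S : {set vertex Q})
    (P : {poly rat}) (m : nat) :
  indivisible v -> is_kac_polynomial v P ->
  (m < apair v v)%N -> decomposition_bound 2 v (apair v v - m.+1) ->
  (forall i, i \in S -> (m <= v i)%N) -> (forall i, i \notin S -> v i = d i) ->
  top_coef P m = stable_series S d m.
Proof.
move=> vi kacP mv dB mS vd.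
have sE := kac_error_bound vi kacP mv dB.
set rho := apair v v in sE mv; set E := (_ - _)%R in sE.
have [sG rG] := gl_poly_reversal v.
have HE : P * gl_poly v = ('X - 1) * 'X^rho + E by rewrite /E addrC subrK.
have sX : size (('X - 1) * 'X^rho : {poly rat}) = rho.+2.
  by rewrite size_mulXn ?polyXsubC_eq0 // -polyC1 size_XsubC addnC.
have sH : size (P * gl_poly v) = rho.+2 by rewrite HE size_polyDl sX //; lia.
have [P0 G0] : P != 0 /\ gl_poly v != 0.
  by apply/andP; rewrite -negb_or -mulf_eq0 -size_poly_eq0 sH.
have sG' : size (gl_poly v) = (gl_degree v).+1.
  apply/eqP; rewrite eqn_leq sG ltnNge; apply/negP=> sG1.
  have := congr1 (fun p : {poly rat} => p`_0) rG.
  rewrite coef_reversal leq0n subn0 nth_default // coef0_prod => [/esym/eqP|i _].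
    by rewrite oner_eq0.
  exact: coef0_qfact.
set D := (size P).-1.
have sP : size P = D.+1 by rewrite prednK // size_poly_gt0.
have DG : (D + gl_degree v = rho.+1)%N.
  by have := size_mul P0 G0; rewrite sH sP sG'; lia.
have := reversalM (eq_leq sP) sG; rewrite rG DG HE reversalD => e.
have revX : reversal rho.+1 (('X - 1) * 'X^rho) = 1 - 'X.
  rewrite mulrBl mul1r -exprS reversalD reversalN !reversalXn // subnn expr0.
  by rewrite subSn // subnn.
have -> : top_coef P m = (reversal D P)`_m.
  by rewrite /top_coef coef_reversal sP ltnS.
apply: (stable_series_unique mS vd) => // k km.
rewrite -e revX coefD coef_reversal.
have -> : (k <= rho.+1)%N by lia.
by rewrite [E`__]nth_default ?addr0 //; apply: leq_trans sE _; lia.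
Qed.

Theorem theorem1p1 (Q : quiver) (hQ : loop_free Q)
  (d delta : dimvec Q)
  (hdelta : imaginary_root (to_lattice delta))
  (hstar : condition_star delta)
  (A : dimvec Q -> {poly rat})
  (hA : forall v : dimvec Q, is_kac_polynomial v (A v)) :
  exists a : nat -> rat,
    (forall i : nat, exists N : nat, forall n : nat, (N <= n)%N ->
       indivisible (d + delta *+ n) -> top_coef (A (d + delta *+ n)) i = a i) /\
    a =1 fps_div
           (fps_mul (fps_of_poly (1 - 'X))
                    (colored_partition_series #|supp delta|))
           (fps_of_poly (\prod_(i : vertex Q | i \notin supp delta)
                           \prod_(1 <= k < (d i).+1) (1 - 'X^k))).
Proof.
exists (stable_series (supp delta) d); split=> // i.
have [neg _] := hstar; have con := root_support_connected hdelta.1.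
have [N kac] := kac_bound d i.+1 con neg.
(* For [n >= i] the entries of [d + n delta] on the support are at least [i], so the
   truncated products agree with the infinite ones up to degree [i]. *)
exists (maxn N i) => n; rewrite geq_max => /andP[/kac[neg_v kac_v] ni] vi.
have [rho_gt dB] := decomposition_bound_of_kac (proj1 (andP vi)) neg_v kac_v.
apply: top_coef_stable vi (hA _) rho_gt dB _ _ => j; rewrite inE dimvecD dimvecMn.
  by rewrite -lt0n => dj; apply: leq_trans ni _; rewrite -[leqLHS]mul1n; nia.
by rewrite negbK => /eqP->; rewrite mul0n addn0.
Qed.
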